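(* Let $\Gamma$ be a locally linearly independent configuration with associated tree $T$, let $\underline x\in\mathbb Z_{\ge0}^{V(T)}$, and let $M,M'\in\mathrm{Gr}(\underline x,M_\Gamma)$ be two subrepresentations of $M_\Gamma$ of dimension $\underline x$. Write $M\cong\big(\bigoplus_{v\in V(T)}P_v^{r_v}\big)\oplus\big(\bigoplus_{\vec e\in\vec E(T)}R_{\vec e}^{r_{\vec e}}\big)$. (1) If there is $\vec\iota\in\vec E(T)$ such that $r_{\vec\iota}>0$ and $r_{\overleftarrow\iota}>0$, then there is a representation $N\in\mathrm{Gr}(\underline x,M_\Gamma)$ such that $\mathcal S_M\subset\mathcal S^c_N$ and $$N\cong\Big(\bigoplus_{v\in V(T)}P_v^{r_v}\Big)\oplus\Big(\bigoplus_{\vec e\in\vec E(T)\setminus\{\vec\iota,\overleftarrow\iota\}}R_{\vec e}^{r_{\vec e}}\Big)\oplus R_{\vec\iota}^{r_{\vec\iota}-1}\oplus R_{\overleftarrow\iota}^{r_{\overleftarrow\iota}-1}\oplus P_{s(\vec\iota)}.$$ (2) $M\prec M'$ if and only if $\Phi_{\underline x}(M)\le\Phi_{\underline x}(M')$.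
   Context: Let $R$ be a discrete valuation ring with uniformizer $\pi$, fraction field $K$ and algebraically closed residue field $\kappa$, and $V$ a $K$-vector space of dimension $d$. $[L]$ denotes the homothety class of a lattice $L\subset V$. Two distinct classes are adjacent if they have representatives with $\pi L\subset L'\subset L$. A finite non-empty set $\Gamma=\{[L_i]\}_{i\in I}$ of classes (distinct indices giving distinct classes) is convex if $[L\cap L']\in\Gamma$ whenever $[L],[L']\in\Gamma$. Fix representatives $L_i$; let $n_{i,j}$ be the minimal integer with $\pi^{n_{i,j}}L_i\subset L_j$, $\overline L_i=L_i/\pi L_i$, and $f_{i,j}\colon\overline L_i\to\overline L_j$ the map induced by multiplication by $\pi^{n_{i,j}}$. A convex $\Gamma$ is locally linearly independent if for every $[L_0]\in\Gamma$ the subspaces $f_{i,0}(\overline L_i)=\ker f_{0,i}$ of $\overline L_0$, for $[L_i]\in\Gamma$ adjacent to $[L_0]$, are linearly independent. Then the graph $T$ with vertex set $V(T)=I$ and edges joining adjacent classes is a tree, and $Q(\Gamma)$ is the quiver with vertex set $V(T)$ and arrow set the set $\vec E(T)$ of oriented edges of $T$ (both orientations of every edge). For $\vec e\in\vec E(T)$: $s(\vec e),t(\vec e)$ are source and target, $\overleftarrow e$ the reverse, $f_{\vec e}=f_{s(\vec e),t(\vec e)}$, and $A_{\vec e}$ is the set of vertices $v$ such that the minimal path in $T$ from $v$ to $s(\vec e)$ does not pass through $t(\vec e)$. $M_\Gamma$ is the representation of $Q(\Gamma)$ with spaces $\overline L_v$ and maps $f_{\vec e}$. Subrepresentations are tuples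 $(U_v)_v$, $U_v\subset\overline L_v$, with $f_{\vec e}(U_{s(\vec e)})\subset U_{t(\vec e)}$; $\mathrm{Gr}(\underline x,M_\Gamma)$ is the quiver Grassmannian (over $\kappa$) of subrepresentations with $\dim U_v=x_v$. $P_u$ is the representation with $\kappa$ at every vertex, $f_{\vec e}=\mathrm{id}$ if $\vec e$ points outwards from $u$ and $0$ otherwise. $R_{\vec\iota}$ is the representation with $\kappa$ at vertices in $A_{\vec\iota}$ and $0$ at the others; $f_{\vec e}=\mathrm{id}$ if both ends of $\vec e$ are in $A_{\vec\iota}$ and $\vec e$ points outwards from $s(\vec\iota)$, and $f_{\vec e}=0$ otherwise. Every subrepresentation of $M_\Gamma$ is isomorphic to a direct sum of $P_v$'s and $R_{\vec e}$'s with uniquely determined multiplicities. $\mathcal S_M\subset\mathrm{Gr}(\underline x,M_\Gamma)$ is the set of dimension-$\underline x$ subrepresentations of $M_\Gamma$ isomorphic to $M$, and $\mathcal S_M^c$ is its closure. $M\prec M'$ means $M\in\mathcal S^c_{M'}$. $\Phi_{\underline x}\colon\mathrm{Gr}(\underline x,M_\Gamma)\to\mathbb Z_{\ge0}^{\vec E(T)}$ sends $(U_v)_v$ to $(\dim f_{\vec e}(U_{s(\vec e)}))_{\vec e}$, and $\le$ is the coordinatewise order. *)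

(* Defs.v *)
(* [mpoly] comes first because it shadows [symmetric]. *)
From mathcomp Require Import mpoly.
From mathcomp Require Import all_boot all_order all_algebra.
From mathcomp Require Import boolp classical_sets.

Set Implicit Arguments.
Unset Strict Implicit.
Unset Printing Implicit Defensive.

Import GRing.Theory.
Local Open Scope ring_scope.
Local Open Scope classical_set_scope.

(* [R] is a discrete valuation ring with uniformizer [p]; the exponent [n] is
   the valuation of [x]. *)
Definition is_dvr (R : idomainType) (p : R) : Prop :=
  [/\ p != 0, p \isn't a GRing.unit &
      forall x : R, x != 0 ->
        exists n : nat, exists2 u : R, u \is a GRing.unit & x = u * p ^+ n].

(* The field [kappa], together with [res], is a model of [R / (p)]. *)
Definition is_residue_map (R : idomainType) (p : R) (kappa : fieldType)
    (res : {rmorphism R -> kappa}) : Prop :=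
  (forall y, exists x, res x = y) /\
  (forall x, res x = 0 <-> exists y, x = p * y).

Section Lattices.
Variables (R : idomainType) (p : R).
Variable V : vectType {fraction R}.
Implicit Types A B L : set V.

Definition scale_set (a : {fraction R}) L : set V := [set a *: x | x in L].

(* A lattice is the [R]-span of a [{fraction R}]-basis of [V]. *)
Definition is_lattice L : Prop :=
  exists b : (\dim {:V}).-tuple V, basis_of fullv b /\
    L = [set x | exists c : 'I_(\dim {:V}) -> R,
                   x = \sum_i tofrac (c i) *: b`_i].

Definition homothetic L L' : Prop :=
  exists2 a : {fraction R}, a != 0 & L' = scale_set a L.

Definition adjacent L L' : Prop :=
  exists A B, [/\ homothetic L A, homothetic L' B,
                  scale_set (tofrac p) A `<=` B & B `<=` A].

Definition is_min_exponent L L' (n : int) : Prop :=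
  scale_set (tofrac p ^ n) L `<=` L' /\
  forall m : int, scale_set (tofrac p ^ m) L `<=` L' -> n <= m.

(* [red], restricted to [L], exhibits [Lbar] as the [kappa]-vector space
   [L / p L]; the values of [red] outside [L] are irrelevant. *)
Definition is_reduction (kappa : fieldType) (res : {rmorphism R -> kappa})
    L (Lbar : vectType kappa) (red : V -> Lbar) : Prop :=
  [/\ forall x y, L x -> L y -> red (x + y) = red x + red y,
      forall a x, L x -> red (tofrac a *: x) = res a *: red x,
      forall y, exists2 x, L x & red x = y
    & forall x, L x -> (red x = 0 <-> scale_set (tofrac p) L x)].

Section Configurations.
Variables (I : finType) (L : I -> set V).

Definition is_configuration : Prop :=
  [/\ (0 < #|I|)%N, forall i, is_lattice (L i)
    & forall i j, homothetic (L i) (L j) -> i = j].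

Definition is_convex : Prop :=
  forall (i j : I) A B, homothetic (L i) A -> homothetic (L j) B ->
    exists k, homothetic (L k) (A `&` B).

(* [adjacent] is symmetric as soon as [p != 0]; symmetrizing it here makes the
   reversal of an edge definable without that hypothesis. *)
Definition class_graph : rel I := fun i j =>
  (i != j) && `[< adjacent (L i) (L j) \/ adjacent (L j) (L i) >].

Lemma class_graph_sym : symmetric class_graph.
Proof.
move=> i j; rewrite /class_graph eq_sym; congr (_ && _).
by apply: asbool_equiv_eq; split; case; [right | left | right | left].
Qed.

Definition locally_linearly_independent (kappa : fieldType)
    (Lbar : I -> vectType kappa) (f : forall i j, 'Hom(Lbar i, Lbar j)) : Prop :=
  forall i0 : I, directv (\sum_(i | class_graph i i0) limg (f i i0)).

End Configurations.
End Lattices.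

Section OrientedEdges.
Variables (I : finType) (T : rel I).

Definition oedge := {e : I * I | T e.1 e.2}.

Definition source (e : oedge) : I := (val e).1.
Definition target (e : oedge) : I := (val e).2.

Definition reverse (symT : symmetric T) (e : oedge) : oedge :=
  Sub (target e, source e) (etrans (symT (target e) (source e)) (valP e)).

(* [v :: q] is a path of minimal length from [v] to [w]. *)
Definition minimal_path (v w : I) (q : seq I) : Prop :=
  [/\ path T v q, last v q = w
    & forall q', path T v q' -> last v q' = w -> (size q <= size q')%N].

(* The set [A_e]; [e] points outwards from [u] exactly when [u \in branch e]. *)
Definition branch (e : oedge) : {set I} :=
  [set v | `[< exists2 q, minimal_path v (source e) q
                         & target e \notin v :: q >]]%SET.

End OrientedEdges.

Section Representations.
Variables (kappa : fieldType) (I : finType) (T : rel I).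
Local Notation oedge := (oedge T).

Record qrep := QRep {
  qspace :> I -> vectType kappa;
  qmap : forall e : oedge, 'Hom(qspace (source e), qspace (target e)) }.

Definition qiso (M N : qrep) : Prop :=
  exists phi : forall v, 'Hom(M v, N v),
    (forall v, bijective (phi v)) /\
    (forall (e : oedge) (x : M (source e)),
       phi (target e) (qmap M e x) = qmap N e (phi (source e) x)).

Definition qzero : qrep :=
  @QRep (fun=> 'rV[kappa]_0 : vectType kappa) (fun=> 0).

Definition qsum (M N : qrep) : qrep :=
  @QRep (fun v => (M v * N v)%type : vectType kappa)
    (fun e => linfun (fun x => (qmap M e x.1, qmap N e x.2))).

Definition qpow (M : qrep) (n : nat) : qrep := iter n (qsum M) qzero.

Definition qbigsum (J : finType) (Q : pred J) (M : J -> qrep) : qrep :=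
  \big[qsum/qzero]_(j | Q j) M j.

Definition P_rep (u : I) : qrep :=
  @QRep (fun=> kappa^o : vectType kappa)
    (fun e => if u \in branch e then \1%VF else 0).

(* ['rV_(v \in branch i)] is a line if [v \in branch i] and is zero otherwise;
   [pid_mx 1] is the identity matrix when both dimensions are 1. *)
Definition R_rep (i : oedge) : qrep :=
  @QRep (fun v => 'rV[kappa]_(v \in branch i) : vectType kappa)
    (fun e => if [&& source e \in branch i, target e \in branch i
                   & source i \in branch e]
              then linfun (mulmxr (pid_mx 1)) else 0).

(* The representation [M_Gamma], given the maps [f i j] between the spaces
   [Lbar i] for all pairs of vertices. *)
Definition config_rep (Lbar : I -> vectType kappa)
    (f : forall i j, 'Hom(Lbar i, Lbar j)) : qrep :=
  @QRep Lbar (fun e => f (source e) (target e)).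

Section Subrepresentations.
Variable W : qrep.

Definition subspaces := forall v, {vspace W v}.
Implicit Types U : subspaces.

Definition is_subrep U : Prop :=
  forall e : oedge, (qmap W e @: U (source e) <= U (target e))%VS.

(* [vsproj] is the identity on the image of [qmap W e] when [U] is a
   subrepresentation. *)
Definition subrep U : qrep :=
  @QRep (fun v => subvs_of (U v) : vectType kappa)
    (fun e => linfun (fun y => vsproj (U (target e)) (qmap W e (vsval y)))).

(* The closed points of the quiver Grassmannian. *)
Definition quiver_gr (x : I -> nat) : set subspaces :=
  [set U | is_subrep U /\ forall v, \dim (U v) = x v].

Definition rank_vector U : oedge -> nat :=
  fun e => \dim (qmap W e @: U (source e)).

Section Zariski.
Variable x : I -> nat.

Definition pl_index :=
  {v : I & {ffun 'I_(x v) -> 'I_(\dim {: W v})}}.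

(* Pluecker coordinates with respect to the basis [vbasis fullv] of [W v].
   Letting [J] range over all functions instead of the increasing ones only
   repeats the usual coordinates up to sign and adds zero coordinates. *)
Definition pluecker U (k : pl_index) : kappa :=
  \det (\matrix_(a < x (tag k), b < x (tag k))
          coord (vbasis fullv) (tagged k b) (vbasis (U (tag k)))`_a).

Definition multihomogeneous (m : I -> nat) (f : {mpoly kappa[#|{: pl_index}|]})
    : Prop :=
  forall mon, mon \in msupp f ->
    forall v, (\sum_(k | tag (enum_val k) == v) mon k)%N = m v.

Definition pl_vanishes (f : {mpoly kappa[#|{: pl_index}|]}) U : Prop :=
  f.@[fun k => pluecker U (enum_val k)] = 0.

Definition zariski_closed (Z : set subspaces) : Prop :=
  exists2 F : set {mpoly kappa[#|{: pl_index}|]},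
    (forall f, F f -> exists m, multihomogeneous m f) &
    Z = [set U | quiver_gr x U /\ forall f, F f -> pl_vanishes f U].

Definition zariski_closure (S : set subspaces) : set subspaces :=
  [set U | forall Z, zariski_closed Z -> S `<=` Z -> Z U].

Definition stratum (M : qrep) : set subspaces :=
  [set U | quiver_gr x U /\ qiso (subrep U) M].

Definition degenerates (U U' : subspaces) : Prop :=
  zariski_closure (stratum (subrep U')) U.

End Zariski.
End Subrepresentations.
End Representations.

Arguments quiver_gr {kappa I T} W x.
Arguments stratum {kappa I T} W x M.
Arguments zariski_closure {kappa I T} W x S.
Arguments zariski_closed {kappa I T} W x Z.

(* Main.v *)
(* Write [a = s(e)], [z = t(e)]. Every subrepresentation [U] has a basis adapted
   to a decomposition into [P]'s and [R]'s, and dimensions and ranks recover the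
   multiplicities; in particular
     [dim U_a = r_e + rank (f_e | U_a) + rank (f_{rev e} | U_z)].
   If [R_e] and [R_{rev e}] are generated by [g] in [U_a] and [g'] in [U_z],
     then
   [g'] lies in [ker f_{rev e} = im f_e], say [g' = f_e w]. Replacing [g] by
   [g + t w] and dropping [g'] turns the two summands into one copy of [P_a]:
   for almost all [t] this gives a subrepresentation [N_t] of the same
     dimension,
   whose limit at [t = 0] is [U] because the minors of a basis depend
   polynomially on [t]. Only the rank along [e] changes, and it grows by one.
   Conversely, if [Phi U <= Phi U'] and the rank along [e] differs, then the
   displayed formula forces [r_e > 0] and [r_{rev e} > 0] in [U], so [U] is a
   limit of [N_t] with [Phi N_t <= Phi U'], and one inducts on the rank defect.
   That ranks drop on closures is a condition linear in Pluecker coordinates. *)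
From HB Require Import structures.
Require Import Defs.
From mathcomp Require Import mpoly.
From mathcomp Require Import all_boot all_order all_algebra.
From mathcomp Require Import boolp classical_sets zify ring.

Set Implicit Arguments.
Unset Strict Implicit.
Unset Printing Implicit Defensive.

Import Order.TTheory GRing.Theory Num.Theory.
Local Open Scope ring_scope.
Local Open Scope classical_set_scope.

(** * Lattices *)

(** The lattices serve only to prove [transition_system]; all the rest is linear algebra over
    [kappa]. That [T] is a tree is never phrased through cycles. It is used as two facts on
    distances: adjacent vertices are never equidistant from a third one ([dist_edge_cases]), and a
    vertex has a single neighbour closer to a given other vertex ([dist_pred_unique]). Both rest on
    [f u v != 0] and on the independence of the images at a vertex.

    The adapted basis comes from choosing complements in each [U u]. The transported generators span
    because every vector can be traced back to where it is generated. Independence is obtained by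
    counting: dimensions and numbers of generators obey the same recursion over branches, which has
    only one solution ([flow_unique]). From then on isomorphism classes are handled as multiplicity
    functions.

    Limits are replaced by polynomials in [t]: an equation valid on the generic [N_t] yields a
    polynomial vanishing at every point, hence zero since [kappa] is algebraically closed, and it
    can be evaluated at 0. *)

Section Lattices.
Variables (R : idomainType) (p : R).
Variable V : vectType {fraction R}.
Implicit Types (A B L : set V) (a b : {fraction R}).

Lemma scale_setE a L L' :
  scale_set a L `<=` L' <-> forall y, L y -> L' (a *: y).
Proof.
split=> [sub y Ly | sub _ [y Ly <-]]; last exact: sub.
by apply: sub; exists y.
Qed.

Lemma is_latticeZ L (c : R) x : is_lattice L -> L x -> L (tofrac c *: x).
Proof.
move=> [b [_ ->]] [d ->]; exists (fun i => c * d i).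
by rewrite scaler_sumr; apply: eq_bigr => i _; rewrite tofracM scalerA.
Qed.

Lemma homothetic_refl L : homothetic L L.
Proof.
exists 1; rewrite ?oner_neq0 //; apply/seteqP; split=> [y Ly | _ [y Ly <-]].
  by exists y; rewrite ?scale1r.
by rewrite scale1r.
Qed.

Lemma homothetic_scale a L : a != 0 -> homothetic L (scale_set a L).
Proof. by exists a. Qed.

Lemma scale_setK a L : a != 0 -> scale_set a^-1 (scale_set a L) = L.
Proof.
move=> a0; apply/seteqP; split=> [_ [_ [y Ly <-] <-] | y Ly].
  by rewrite scalerK.
by exists (a *: y); [exists y | rewrite scalerK].
Qed.

Lemma homothetic_sym L L' : homothetic L L' -> homothetic L' L.
Proof.
by move=> [a a0 ->]; exists a^-1; rewrite ?invr_eq0 // scale_setK.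
Qed.

Lemma homothetic_trans L L' L'' :
  homothetic L L' -> homothetic L' L'' -> homothetic L L''.
Proof.
move=> [a a0 ->] [b b0 ->]; exists (b * a); first by rewrite mulf_neq0.
apply/seteqP; split=> [_ [_ [y Ly <-] <-] | _ [y Ly <-]].
  by exists y; rewrite ?scalerA.
by exists (a *: y); [exists y | rewrite scalerA].
Qed.

Hypothesis hR : is_dvr p.
Let pf : {fraction R} := tofrac p.

Lemma uniformizer_neq0 : pf != 0.
Proof. by case: hR => p0 _ _; rewrite tofrac_eq0. Qed.

Lemma fraction_repr a : exists r s : R, s != 0 /\ a = tofrac r / tofrac s.
Proof.
elim/quotW: a => x; exists \n_x, \d_x; split; first exact: denom_ratioP.
apply: (canRL (mulfK _)); first by rewrite tofrac_eq0 denom_ratioP.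
rewrite /FracField.tofrac; unlock.
rewrite -[LHS]FracField.pi_mul; apply/eqmodP => /=.
rewrite FracField.equivfE /FracField.mulf !numden_Ratio ?oner_eq0 //.
  by rewrite !mulr1 mulrC.
all: by rewrite mulr1 denom_ratioP.
Qed.

Lemma fraction_valuation a : a != 0 ->
  exists (k : int) (u : R), u \is a GRing.unit /\ a = tofrac u * pf ^ k.
Proof.
case: hR => p0 pU val a0; have [r [s [s0 ra]]] := fraction_repr a.
have r0 : r != 0 by apply: contraNneq a0 => r0; rewrite ra r0 tofrac0 mul0r.
have [m [u uU ru]] := val r r0; have [m' [w wU sw]] := val s s0.
exists (m%:Z - m'%:Z), (u / w); split; first by rewrite unitrM uU unitrV.
have wf0 : tofrac w != 0.
  by rewrite tofrac_eq0; apply: contraTneq wU => ->; rewrite unitr0.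
rewrite expfzDr ?uniformizer_neq0 // -exprnN -exprnP ra ru sw !tofracM
  !tofracXn.
have -> : tofrac w^-1 = (tofrac w)^-1.
  by apply: (mulfI wf0); rewrite -tofracM divrr // mulfV.
by rewrite invfM mulrACA.
Qed.

(** * Minimal exponents and reduced maps of a configuration *)

Section Configuration.
Variables (kappa : fieldType) (res : {rmorphism R -> kappa}).
Variables (I : finType) (L : I -> set V).
Hypotheses (hL : is_configuration L) (hconv : is_convex L).
Variable n : I -> I -> int.
Hypothesis hn : forall i j, is_min_exponent p (L i) (L j) (n i j).
Variables (Lbar : I -> vectType kappa) (red : forall i, V -> Lbar i).
Hypothesis hred : forall i, is_reduction p res (L i) (red i).
Variable f : forall i j, 'Hom(Lbar i, Lbar j).
Hypothesis hf : forall i j (y : V), L i y ->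
  f i j (red i y) = red j (tofrac p ^ n i j *: y).
Implicit Types i j k : I.

Let Llat i : is_lattice (L i).
Proof. by case: hL. Qed.

Let pf0 : pf != 0 := uniformizer_neq0.

Lemma exponent_sub i j y : L i y -> L j (pf ^ n i j *: y).
Proof. by have [/scale_setE + _] := hn i j; apply. Qed.

Lemma lattice_pZ i (m : int) y : 0 <= m -> L i y -> L i (pf ^ m *: y).
Proof.
case: m => // m _ Ly; rewrite -exprnP -tofracXn.
exact: is_latticeZ.
Qed.

(** Lattices are stable under [p], so the exponents carrying [L i] into [L j] form an up-set; every
    bound on [n] becomes an inclusion. *)
Lemma exponent_minP i j (m : int) :
  reflect (forall y, L i y -> L j (pf ^ m *: y)) (n i j <= m).
Proof.
apply: (iffP idP) => [nm y Ly | sub]; last first.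
  by have [_ + ] := hn i j; apply; apply/scale_setE.
rewrite -[m](subrK (n i j)) expfzDr // -scalerA.
by apply: lattice_pZ; rewrite ?subr_ge0 //; apply: exponent_sub.
Qed.

Lemma exponent_diag i : n i i = 0.
Proof.
apply/eqP; rewrite eq_le; apply/andP; split.
  by apply/exponent_minP => y Ly; rewrite expr0z scale1r.
have : n i i <= n i i + n i i.
  apply/exponent_minP => y Ly; rewrite expfzDr // -scalerA.
  by do 2!apply: exponent_sub.
by rewrite lerDl.
Qed.

Lemma exponent_triangle i j k : n i k <= n i j + n j k.
Proof.
apply/exponent_minP => y Ly; rewrite addrC expfzDr // -scalerA.
by do 2!apply: exponent_sub.
Qed.

Lemma red_onto i (z : Lbar i) : exists2 y, L i y & red i y = z.
Proof. by case: (hred i) => _ _ + _; apply. Qed.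

Lemma red_eq0 i y : L i y ->
  red i y = 0 <-> exists2 w, L i w & y = pf *: w.
Proof.
move=> Ly; case: (hred i) => _ _ _ /(_ y Ly) H; split.
  by move/H => [w Lw <-]; exists w.
by case=> w Lw E; apply/H; exists w.
Qed.

Lemma transition_refl i : f i i = \1%VF.
Proof.
apply/lfunP => z; have [y Ly <-] := red_onto z.
by rewrite hf // exponent_diag expr0z scale1r id_lfunE.
Qed.

(** Otherwise the image of [L i] would lie in [p L_j], and the exponent could be lowered by one. *)
Lemma transition_neq0 i j : f i j != 0.
Proof.
apply/eqP => f0; have : n i j <= n i j - 1.
  apply/exponent_minP => y Ly.
  have /(red_eq0 (exponent_sub j Ly)) [w Lw E] :
    red j (pf ^ n i j *: y) = 0 by rewrite -hf // f0 zero_lfunE.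
  by rewrite addrC expfzDr // -scalerA E scalerA exprN1 mulVf // scale1r.
by lia.
Qed.

(** If [n i k = n i j + n j k], both sides are multiplication by the same power; if the sum is
    larger, the composite has a spare factor [p] and vanishes. *)
Lemma transition_comp i j k : (f j k \o f i j)%VF != 0 ->
  (f j k \o f i j)%VF = f i k.
Proof.
have [lt_n | ge_n] := ltP (n i k) (n i j + n j k).
  case/eqP; apply/lfunP => z; have [y Ly <-] := red_onto z.
  rewrite comp_lfunE zero_lfunE hf // hf; last exact: exponent_sub.
  apply/red_eq0; first by do 2!apply: exponent_sub.
  exists (pf ^ (n i j + n j k - 1) *: y).
    by apply: (exponent_minP _ _ _ _ _ Ly); lia.
  rewrite !scalerA -expfzDr // -[X in X * _]expr1z -expfzDr //.
  by congr (_ ^ _ *: _); lia.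
move=> _; apply/lfunP => z; have [y Ly <-] := red_onto z.
rewrite comp_lfunE !hf //; last exact: exponent_sub.
rewrite scalerA -expfzDr //; congr (red _ (_ ^ _ *: _)).
by have := exponent_triangle i j k; lia.
Qed.

Let T := class_graph p L.

(** For representatives [a L_i] and [b L_j] with [a / b = u p^k], the two inclusions say
    [n i j <= k + 1] and [n j i <= - k]. The sum is nonnegative by the triangle inequality, and 0
    would make the lattices homothetic. *)
Lemma adjacent_exponent i j : T i j -> n i j + n j i = 1.
Proof.
suff H i' j' : i' != j' -> adjacent p (L i') (L j') ->
    n i' j' + n j' i' = 1.
  case/andP=> ij /asboolP [|] A; first exact: H.
  by rewrite addrC; apply: H; rewrite // eq_sym.
move=> {}ij [_ [_ [[a a0 ->] [b b0 ->] sub1 sub2]]].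
have ab0 : a / b != 0 by rewrite mulf_neq0 ?invr_eq0.
have [k [u [uU Eab]]] := fraction_valuation ab0.
have uf0 : tofrac u != 0.
  by rewrite tofrac_eq0; apply: contraTneq uU => ->; rewrite unitr0.
have uV : tofrac u^-1 = (tofrac u)^-1.
  by apply: (mulfI uf0); rewrite -tofracM divrr // mulfV.
have Ea : a = tofrac u * pf ^ k * b by rewrite -Eab divfK.
have le1 : n i' j' <= k + 1.
  apply/exponent_minP => y Ly.
  have [|w Lw E] := sub1 (pf *: (a *: y)).
    by exists (a *: y) => //; exists y.
  have Ew : w = (tofrac u * pf ^ (k + 1)) *: y.
    apply: (scalerI b0); rewrite E !scalerA Ea expfzDr // expr1z.
    by congr (_ *: _); ring.
  have -> : pf ^ (k + 1) *: y = tofrac u^-1 *: w; last exact: is_latticeZ.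
  by rewrite Ew scalerA uV mulKf.
have le2 : n j' i' <= - k.
  apply/exponent_minP => y Ly.
  have [|w Lw E] := sub2 (b *: y); first by exists y.
  have -> : y = (tofrac u * pf ^ k) *: w.
    apply: (scalerI b0); rewrite -E !scalerA Ea.
    by congr (_ *: _); ring.
  have -> : pf ^ (- k) *: ((tofrac u * pf ^ k) *: w) = tofrac u *: w.
    rewrite scalerA mulrCA -expfzDr // addNr expr0z mulr1 //.
  exact: is_latticeZ.
have ge0 := exponent_triangle i' j' i'; rewrite exponent_diag in ge0.
suff : n i' j' + n j' i' != 0 by lia.
apply/eqP => n0; case/eqP: ij; case: hL => _ _; apply.
exists (pf ^ n i' j'); first exact: expfz_neq0.
apply/seteqP; split=> [y Ly | _ [y Ly <-]]; last exact: exponent_sub.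
exists (pf ^ n j' i' *: y); first exact: exponent_sub.
by rewrite scalerA -expfzDr // n0 expr0z scale1r.
Qed.

(** As the exponents add up to 1, the composite is multiplication by [p], that is zero; conversely
    [p^(n i j) y = p w] means [y = p^(n j i) w]. *)
Lemma transition_ker i j : T i j -> lker (f i j) = limg (f j i).
Proof.
move=> /adjacent_exponent n1; apply/vspaceP => z; rewrite memv_ker.
apply/eqP/memv_imgP => [|[x _ ->]]; last first.
  have [y Ly <-] := red_onto x; rewrite hf // hf; last exact: exponent_sub.
  apply/red_eq0; first by do 2!apply: exponent_sub.
  by exists y; rewrite // scalerA -expfzDr // n1 expr1z.
have [y Ly <-] := red_onto z; rewrite hf // => /red_eq0 [|w Lw E].
  exact: exponent_sub.
exists (red j w); rewrite ?memvf // hf //; congr red.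
have -> : n j i = 1 - n i j by lia.
rewrite addrC expfzDr // -scalerA expr1z -E scalerA -expfzDr //.
by rewrite addNr expr0z scale1r.
Qed.

(** The lattices [X k] interpolate between [L j] and [L i], and convexity keeps their classes in the
    configuration. [X 0] is [p^(n j i) L_j], [X k] is [L i] once [n i j + n j i <= k], and
    [p X_(k+1) <= X_k <= X_(k+1)] makes consecutive classes equal or adjacent. *)
Lemma class_graph_connected i j : connect T i j.
Proof.
pose X (k : nat) := L i `&` scale_set (pf ^ (n j i - k%:Z)) (L j).
have conv (k : nat) : exists c, homothetic (L c) (X k).
  apply: hconv; first exact: homothetic_refl.
  by apply: homothetic_scale; rewrite expfz_neq0.
have endj c : homothetic (L c) (X 0%N) -> c = j.
  move=> H; case: hL => _ _; apply; apply: (homothetic_trans H).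
  apply: homothetic_sym; exists (pf ^ n j i); first exact: expfz_neq0.
  rewrite /X subr0 setIC; apply/setIidPl => _ [y Ly <-].
  exact: exponent_sub.
have endi c (k : nat) :
  (n i j + n j i <= k%:Z) -> homothetic (L c) (X k) -> c = i.
  move=> kn H; case: hL => _ _; apply; apply: (homothetic_trans H).
  rewrite /X (_ : _ `&` _ = L i); first exact: homothetic_refl.
  apply/setIidPl => y Ly; exists (pf ^ (k%:Z - n j i) *: y).
    by apply: (exponent_minP _ _ _ _ _ Ly); lia.
  by rewrite scalerA -expfzDr // (_ : _ + _ = 0) ?expr0z ?scale1r //; lia.
have step c c' (k : nat) :
  homothetic (L c) (X k) -> homothetic (L c') (X k.+1) ->
    connect T c' c.
  move=> Hc Hc'; have [-> | cc'] := eqVneq c' c; first exact: connect0.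
  apply: connect1; rewrite /T /class_graph cc' /=; apply/asboolP; left.
  exists (X k.+1), (X k); split => //.
    apply/scale_setE => y [Ly [w Lw Ew]]; split.
      exact: (lattice_pZ (m := 1)).
    exists w => //;
      rewrite -Ew -[tofrac p]/pf -[in RHS](expr1z pf) scalerA -expfzDr //.
    by congr (_ ^ _ *: _); lia.
  move=> y [Ly [w Lw Ew]]; split=> //; exists (pf ^ 1 *: w).
    exact: lattice_pZ.
  by rewrite -Ew scalerA -expfzDr //; congr (_ ^ _ *: _); lia.
have all (k : nat) c : homothetic (L c) (X k) -> connect T c j.
  elim: k c => [c /endj -> | k IH c Hc]; first exact: connect0.
  have [c' Hc'] := conv k.
  exact: connect_trans (step _ _ _ Hc' Hc) (IH _ Hc').
have [k kn] : exists k : nat, n i j + n j i <= k%:Z.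
  by exists (absz (n i j + n j i)); lia.
have [c Hc] := conv k.
by rewrite -{1}(endi c k kn Hc); apply: all Hc.
Qed.

End Configuration.
End Lattices.

(** * The tree of a configuration *)

Section Distance.
Variables (I : finType) (T : rel I).
Implicit Types u v w z : I.

Definition walk u v (k : nat) : bool :=
  [exists q : k.-tuple I, path T u q && (last u q == v)].

Fact dist_subproof u v : exists k, walk u v k || (k == #|I|).
Proof. by exists #|I|; rewrite eqxx orbT. Qed.

(* The junk value [#|I|], for disconnected vertices, exceeds every distance. *)
Definition dist u v : nat := ex_minn (dist_subproof u v).

Lemma walkP u v k :
  reflect (exists q, [/\ path T u q, last u q = v & size q = k]) (walk u v k).
Proof.
apply: (iffP existsP) => [[q /andP[pq /eqP lq]] | [q [pq lq sq]]].
  by exists q; rewrite size_tuple.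
by exists (Tuple (introT eqP sq)); rewrite pq lq eqxx.
Qed.

Hypothesis conn : forall u v, connect T u v.
Hypothesis symT : symmetric T.
Hypothesis irrT : irreflexive T.

Lemma dist_le u v q : path T u q -> last u q = v -> (dist u v <= size q)%N.
Proof.
move=> pq lq; rewrite /dist; case: ex_minnP => m _; apply.
by apply/orP; left; apply/walkP; exists q.
Qed.

Lemma dist_walk u v :
  exists q, [/\ path T u q, last u q = v & size q = dist u v].
Proof.
apply/walkP; rewrite /dist; case: ex_minnP => m /orP[// | /eqP ->] min.
have /connectP [q0 pq0 lq0] := conn u v.
case/shortenP: pq0 lq0 => q pq /card_uniqP /= uq _ lq.
have ltq : (size q < #|I|)%N by rewrite -uq max_card.
have /min : walk u v (size q) || (size q == #|I|).
  by apply/orP; left; apply/walkP; exists q.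
by rewrite leqNgt ltq.
Qed.

Lemma dist_refl u : dist u u = 0%N.
Proof. by apply/eqP; rewrite -leqn0 (@dist_le u u [::]). Qed.

Lemma dist_eq0 u v : dist u v = 0%N -> u = v.
Proof. by move=> d0; have [[|y q] [_ lq]] := dist_walk u v; rewrite d0. Qed.

Lemma dist_step u v w : T v w -> (dist u w <= (dist u v).+1)%N.
Proof.
move=> vw; have [q [pq lq <-]] := dist_walk u v.
by rewrite -(size_rcons q w) dist_le ?rcons_path ?pq ?lq ?last_rcons.
Qed.

Lemma dist_pred u v : u != v -> exists2 w, T w v & dist u v = (dist u w).+1.
Proof.
move=> uv; have [q [pq lq sq]] := dist_walk u v.
case/lastP: q => [|q v'] in pq lq sq; first by rewrite -lq eqxx in uv.
rewrite last_rcons in lq; rewrite lq rcons_path size_rcons in pq sq.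
case/andP: pq => pq lv; exists (last u q) => //.
apply/eqP; rewrite eqn_leq dist_step //= -sq ltnS.
exact: dist_le.
Qed.

Lemma dist_sym u v : dist u v = dist v u.
Proof.
suff le a b : (dist a b <= dist b a)%N by apply/eqP; rewrite eqn_leq !le.
have [q [pq lq <-]] := dist_walk b a.
rewrite -(size_belast b q) -(size_rev (belast b q)) -lq; apply: dist_le.
  by rewrite rev_path (eq_path (e' := T)) // => x y; apply: symT.
case: q {pq lq} => //= y q; rewrite rev_cons last_rcons //.
Qed.

Lemma dist_edge u v : T u v -> dist u v = 1%N.
Proof.
move=> uv; have := dist_step u uv; rewrite dist_refl.
case E: (dist u v) => [|[|//]] // _.
by rewrite (dist_eq0 E) irrT in uv.
Qed.

Lemma dist_le_card u v : (dist u v <= #|I|)%N.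
Proof.
rewrite /dist; case: ex_minnP => m _; apply.
by rewrite eqxx orbT.
Qed.

End Distance.

(** * Geodesics of the graph and composites of the maps along them *)

Section TransitionSystem.
Variables (kappa : fieldType) (I : finType) (T : rel I).
Variables (W : I -> vectType kappa) (f : forall i j, 'Hom(W i, W j)).
Implicit Types u v w z : I.

(* The properties of the maps [f_{i,j}] of a locally linearly independent
   configuration on which everything else rests. *)
Record transition_system : Prop := TransitionSystem {
  ts_sym : symmetric T;
  ts_irr : irreflexive T;
  ts_conn : forall u v, connect T u v;
  ts_refl : forall u, f u u = \1%VF;
  ts_neq0 : forall u v, f u v != 0;
  ts_comp :
    forall u v w, (f v w \o f u v)%VF != 0 -> (f v w \o f u v)%VF = f u w;
  ts_ker : forall u v, T u v -> lker (f u v) = limg (f v u);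
  ts_direct : forall v, directv (\sum_(u | T u v) limg (f u v)) }.

Hypothesis H : transition_system.
Local Notation dist := (dist T).

Let symT := ts_sym H.
Let irrT := ts_irr H.
Let conn := ts_conn H.

Lemma transition_back u v : T u v -> (f v u \o f u v)%VF = 0.
Proof.
move=> uv; apply/lfunP => x; rewrite comp_lfunE zero_lfunE; apply/eqP.
by rewrite -memv_ker (ts_ker H) ?memv_img ?memvf // symT.
Qed.

Lemma limg_disjoint u w v x : T u v -> T w v -> u != w ->
  x \in limg (f u v) -> x \in limg (f w v) -> x = 0.
Proof.
move=> uv wv uw xu xw.
have /directv_sumP /(_ u uv) D := ts_direct H v.
apply/eqP; rewrite -memv0 -D memv_cap xu /=.
by apply: (subvP (sumv_sup w _ (subvv _))) => //; rewrite wv eq_sym.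
Qed.

(** The image of [f u v] lies in that of [f v' v]. Were the composite zero, it would also lie in
    [lker (f v w) = limg (f w v)], which meets the former only in 0, so [f u v] would vanish. *)
Lemma transition_nonbacktracking u v' v w : T v' v -> T v w -> v' != w ->
  f u v = (f v' v \o f u v')%VF -> (f v w \o f u v)%VF = f u w.
Proof.
move=> v'v vw v'w E; apply: (ts_comp H); apply/eqP => E0.
have /eqP := ts_neq0 H u v; apply; apply/lfunP => x; rewrite zero_lfunE.
apply: (limg_disjoint v'v (w := w)) => //; first by rewrite symT.
  by rewrite E comp_lfunE memv_img ?memvf.
by rewrite -(ts_ker H) // memv_ker -comp_lfunE E0 zero_lfunE.
Qed.

Lemma transition_geodesic u v w : T w v -> dist u v = (dist u w).+1 ->
  (f w v \o f u w)%VF = f u v.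
Proof.
move: {2}(dist u w) (erefl (dist u w)) => k.
elim: k w v => [|k IH] w v dw wv dv.
  by rewrite -(dist_eq0 conn dw) (ts_refl H) comp_lfun1r.
have [w' w'w dw'] : exists2 w', T w' w & dist u w = (dist u w').+1.
  apply: (dist_pred conn); apply/eqP => uw.
  by rewrite uw dist_refl in dw.
apply: (transition_nonbacktracking w'w) => //.
  by apply/eqP => E; move: dv; rewrite -E dw'; lia.
by apply/esym/IH => //; lia.
Qed.

(** If [v] and [w] were equidistant from [u], crossing the edge in either direction would not
    backtrack, so [f u v] would factor through [f w v \o f v w = 0]. *)
Lemma dist_edge_cases u v w : T v w ->
  dist u w = (dist u v).+1 \/ dist u v = (dist u w).+1.
Proof.
move=> vw; have wv : T w v by rewrite symT.
have := dist_step conn u vw; have := dist_step conn u wv.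
have [E _ _ | ] := eqVneq (dist u v) (dist u w); last by lia.
have chain a b : T a b -> dist u a = dist u b -> (f a b \o f u a)%VF = f u b.
  move=> ab Eab;
    have [a' a'a da] : exists2 a', T a' a & dist u a = (dist u a').+1.
    apply: (dist_pred conn); apply/eqP => ua.
    by rewrite -ua dist_refl ua in Eab;
      rewrite (dist_eq0 conn (esym Eab)) irrT in ab.
  apply: (transition_nonbacktracking a'a) => //.
    by apply/eqP => E'; move: da; rewrite E' Eab; lia.
  exact/esym/transition_geodesic.
have /eqP := ts_neq0 H u v; case.
by rewrite -(chain w v) // -(chain v w) // comp_lfunA transition_back
  ?comp_lfun0l.
Qed.

(** Two closer neighbours would put the nonzero image of [f u v] inside two independent
    subspaces. *)
Lemma dist_pred_unique u v w w' : T w v -> T w' v ->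
  dist u v = (dist u w).+1 -> dist u v = (dist u w').+1 -> w = w'.
Proof.
move=> wv w'v dw dw'; apply/eqP; apply/negPn/negP => ww'.
have /eqP := ts_neq0 H u v; apply; apply/lfunP => x; rewrite zero_lfunE.
apply: (limg_disjoint wv w'v ww').
  by rewrite -(transition_geodesic wv dw) comp_lfunE memv_img ?memvf.
by rewrite -(transition_geodesic w'v dw') comp_lfunE memv_img ?memvf.
Qed.

(** On an edge leading back towards [u], [f u w] already ends with the opposite edge, and the two
    compose to zero. *)
Lemma transition_edge u v w : T w v ->
  (f w v \o f u w)%VF = if dist u v == (dist u w).+1 then f u v else 0.
Proof.
move=> wv; case: eqP => [/(transition_geodesic wv) // | ne].
have [//|dw] := dist_edge_cases u wv.
have vw : T v w by rewrite symT.
by rewrite -(transition_geodesic vw dw) comp_lfunA transition_back ?comp_lfun0l.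
Qed.

Lemma transition_geodesic_l u v z : T u z -> dist u v = (dist z v).+1 ->
  (f z v \o f u z)%VF = f u v.
Proof.
move=> uz; move: {2}(dist z v) (erefl (dist z v)) => k.
elim: k v => [|k IH] v dz du.
  by rewrite -(dist_eq0 conn dz) (ts_refl H) comp_lfun1l.
have [v' v'v dv'] : exists2 v', T v' v & dist z v = (dist z v').+1.
  apply: (dist_pred conn); apply/eqP => zv.
  by rewrite zv dist_refl in dz.
have le1 : (dist u v' <= (dist z v').+1)%N.
  by rewrite (dist_sym conn symT u) (dist_sym conn symT z) (dist_step conn) //
    symT.
have le2 := dist_step conn u v'v.
rewrite -(transition_geodesic v'v dv') -comp_lfunA IH; try lia.
by apply: transition_geodesic => //; lia.
Qed.

Lemma transition_edge_l u v z : T z u ->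
  (f u v \o f z u)%VF = if dist z v == (dist u v).+1 then f z v else 0.
Proof.
move=> zu; case: eqP => [/(transition_geodesic_l zu) // | ne].
have uz : T u z by rewrite symT.
have [E|E] := dist_edge_cases v zu; move: E;
  rewrite !(dist_sym conn symT v) // => du.
by rewrite -(transition_geodesic_l uz du) -comp_lfunA transition_back
  ?comp_lfun0r.
Qed.

Local Notation source := (@source I T).
Local Notation target := (@target I T).

Lemma oedgeP (e : oedge T) : T (source e) (target e).
Proof. exact: (valP e). Qed.

(** Replaces the minimal paths in [A_e] by a comparison of distances. If [target e] is the closer
    end, uniqueness of the closer neighbour forces every minimal path to [source e] through it. *)
Lemma mem_branch u (e : oedge T) :
  (u \in branch e) = (dist u (target e) == (dist u (source e)).+1).
Proof.
rewrite inE; apply/asboolP/eqP => [[q [pq lq min] tq] | du].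
  have [//|ds] := dist_edge_cases u (oedgeP e).
  have sq : (size q <= dist u (source e))%N.
    by have [q' [pq' lq' <-]] := dist_walk conn u (source e); apply: min.
  case/lastP: q => [|q v'] in pq lq min tq sq.
    by move: lq ds => /= <-; rewrite dist_refl.
  rewrite last_rcons in lq; rewrite lq rcons_path size_rcons in pq sq.
  case/andP: pq => pq lv; case/negP: tq.
  have -> : target e = last u q.
    apply: (dist_pred_unique (u := u) (v := source e)) => //.
      by rewrite symT; apply: oedgeP.
    have := dist_le pq (erefl _); have := dist_step conn u lv; lia.
  by rewrite lq -rcons_cons mem_rcons inE mem_last orbT.
have [q [pq lq sq]] := dist_walk conn u (source e).
exists q; first by split=> // q' pq' lq'; rewrite sq; apply: dist_le.
apply/negP => tq; case/splitPl: tq => q1 q2 lq1 in pq lq sq.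
have /dist_le - /(_ _ lq1) : path T u q1 by move: pq;
  rewrite cat_path => /andP[].
by rewrite du -sq size_cat; lia.
Qed.

End TransitionSystem.

(** * Supports and transition ranks of the indecomposable summands *)

Section Summands.
Variables (I : finType) (T : rel I).
Implicit Types u v w : I.

(* [inl u] stands for [P_u] and [inr e] for [R_e]. *)
Definition summand : Type := (I + oedge T)%type.
HB.instance Definition _ := Finite.on summand.

Implicit Types c : summand.

Definition origin c : I :=
  match c with inl u => u | inr e => source e end.

(** On an edge [v -> w]: it points outwards from [u]. By [mem_branch],
    [away v (source e) (target e)] also expresses that [v] is in [A_e]. *)
Definition away u v w : bool := dist T u w == (dist T u v).+1.

Definition support c v : bool :=
  match c with inl _ => true | inr e => away v (source e) (target e) end.

Definition kernel_at c v w : bool :=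
  if c is inr e then val e == (v, w) else false.

(** The rank of the summand [c] along [v -> w]. Testing the support at [w] is enough, since
    [away_upstream] gives it at [v]. *)
Definition transmits c v w : bool := away (origin c) v w && support c w.

End Summands.

Section SummandCombinatorics.
Variables (kappa : fieldType) (I : finType) (T : rel I).
Variables (W : I -> vectType kappa) (f : forall i j, 'Hom(W i, W j)).
Hypothesis H : transition_system T f.
Implicit Types (u v w : I) (c : summand T).
Local Notation dist := (dist T).
Local Notation away := (away T).

Let symT := ts_sym H.
Let irrT := ts_irr H.
Let conn := ts_conn H.

Lemma away_sym u v w : T v w -> away u w v = ~~ away u v w.
Proof.
move=> vw; rewrite /away.
by have [-> | ->] := dist_edge_cases H u vw; apply/idP/idP; lia.
Qed.

Lemma away_edge v w : T v w -> away v v w.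
Proof. by move=> vw; rewrite /away dist_refl (dist_edge conn irrT). Qed.

(** An edge leaving the branch of [a] must be [a -> b]. Otherwise [z] has a neighbour closer to [b],
    which is also closer to [a]; by uniqueness it is [y], which is then too near to [b]. *)
Lemma crossing_edge a b y z : T a b -> T y z ->
  away a y z -> away y a b -> ~~ away z a b -> y = a /\ z = b.
Proof.
move=> ab yz; rewrite -away_sym // /away => /eqP az /eqP.
rewrite !(dist_sym conn symT y) => yb /eqP;
  rewrite !(dist_sym conn symT z) => bz.
case k0 : (dist a y) => [|k].
  have E := dist_eq0 conn k0; split=> //.
  by rewrite [RHS](@dist_eq0 I T conn _ z) //; lia.
have [w wz bw] : exists2 w, T w z & dist b z = (dist b w).+1.
  apply: (dist_pred conn); apply/eqP => bz0.
  by move: bz az k0; rewrite -bz0 dist_refl; lia.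
have le1 := dist_step conn a wz.
have le2 : (dist a w <= (dist b w).+1)%N.
  by rewrite !(dist_sym conn symT _ w) (dist_step conn) // symT.
have Ewy : w = y by apply: (dist_pred_unique H (u := a) (v := z)) => //; lia.
by move: bw yb; rewrite Ewy; lia.
Qed.

Lemma away_upstream a b y z : T a b -> T y z ->
  away a y z -> away z a b -> away y a b.
Proof.
move=> ab yz; rewrite /away => /eqP az /eqP.
rewrite !(dist_sym conn symT z) !(dist_sym conn symT y) => bz.
have := dist_step conn b yz; have := dist_edge_cases H y ab.
by rewrite !(dist_sym conn symT y) => -[] ? ?; apply/eqP; lia.
Qed.

(* At [v], the homology [ker f_{v,w} / im f_{w,v}] comes from [R_{(v,w)}] only. *)
Lemma support_edge c v w : T v w ->
  support c v = (kernel_at c v w + transmits c w v + transmits c v w)%N :> nat.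
Proof.
move=> vw; have wv : T w v by rewrite symT.
rewrite /transmits; case: c => [u | e] /=.
  by rewrite !andbT (away_sym _ vw); case: away.
set a := source e; set b := target e; have ab : T a b := oedgeP e.
have -> : (val e == (v, w)) = (a == v) && (b == w).
  by rewrite /a /b /source /target; case: (val e).
rewrite (away_sym a vw); case: (boolP (away a v w)) => avw /=.
  have [bw | nbw] := boolP (away w a b).
    rewrite (away_upstream ab vw) //.
    by case: andP => // -[_ /eqP E]; rewrite E /away dist_refl in bw.
  have [bv | nbv] := boolP (away v a b).
    by have [<- <-] := crossing_edge ab vw avw bv nbw; rewrite !eqxx.
  by case: andP => // -[/eqP E _]; rewrite -E away_edge in nbv.
rewrite addn0; case: andP => // -[/eqP E _].
by rewrite E away_edge in avw.
Qed.

Lemma sum_away u v (b : bool) :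
  (\sum_(w | T v w) (away u w v && b) = ((u != v) && b))%N.
Proof.
have [-> | uv] /= := eqVneq u v.
  by rewrite big1 // => w _; rewrite /away dist_refl.
have [w wv dw] := dist_pred conn uv.
have vw : T v w by rewrite symT.
rewrite (bigD1 w) //= big1 => [|w' /andP[w'v ww']].
  by rewrite addn0 /away dw eqxx.
rewrite /away; case: eqP => // dw'; case/eqP: ww'.
by apply: (dist_pred_unique H (u := u) (v := v)); rewrite // symT.
Qed.

(** The line of a summand at [v] either is spanned by its generator, counted by [c == inl v] or by
    [kernel_at], or arrives from exactly one neighbour. *)
Lemma support_vertex c v : support c v =
  ((c == inl v) + \sum_(w | T v w) (kernel_at c v w + transmits c w v))%N :>
    nat.
Proof.
rewrite big_split /= sum_away; case: c => [u | e] /=.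
  by rewrite big1 // andbT;
    rewrite (_ : (inl u == inl v :> summand T) = (u == v)) //; case: eqP.
set a := source e; set b := target e; have ab : T a b := oedgeP e.
have -> : (\sum_(w | T v w) (val e == (v, w)) = (a == v))%N.
  have [E | av] := eqVneq a v; last first.
    rewrite big1 // => w _; case: eqP => // E.
    by case/eqP: av; apply: (congr1 fst E).
  rewrite -E (bigD1 b) //= big1 => [|w /andP[_ wb]]; last first.
    by case: eqP => // E'; case/eqP: wb; apply: esym (congr1 snd E').
  by rewrite addn0 /a /b /source /target -surjective_pairing eqxx.
rewrite add0n; case: eqP => [<- | //].
by rewrite away_edge.
Qed.

(** This is why trading [R_e] and its reverse for one [P] preserves the dimension vector. *)
Lemma support_reverse (e : oedge T) v :
  (support (inr e : summand T) v +
   support (inr (reverse symT e) : summand T) v)%N = 1%N.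
Proof. by rewrite /= (away_sym v (oedgeP e)); case: away. Qed.

(** Inside [A_e] the arrows of [P_(s(e))] are those of [R_e]. Beyond [e], outwards from [s(e)] and
    outwards from [t(e)] mean the same, which gives the arrows of the reverse summand. The one new
    nonzero arrow is [e], joining the two pieces. *)
Lemma transmits_reverse (e : oedge T) v w : T v w ->
  transmits (inl (source e) : summand T) v w =
  (transmits (inr e : summand T) v w +
   transmits (inr (reverse symT e) :
     summand T) v w + (val e == (v, w)))%N :> nat.
Proof.
move=> vw; have wv : T w v by rewrite symT.
rewrite /transmits /= andbT.
set a := source e; set b := target e; have ab : T a b := oedgeP e.
have ba : T b a by rewrite symT.
rewrite -[source (reverse _ _)]/b -[target (reverse _ _)]/a.
have -> : (val e == (v, w)) = (a == v) && (b == w).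
  by rewrite /a /b /source /target; case: (val e).
have nE : away w a b -> (a == v) && (b == w) = false.
  by move=> aw; apply/andP => -[_ /eqP E]; rewrite -E /away dist_refl in aw.
have parallel : away v b a -> away w b a -> away a v w = away b v w.
  rewrite /away !(dist_sym conn symT v) !(dist_sym conn symT w).
  by move=> /eqP -> /eqP ->.
rewrite (away_sym w ab).
have [aw | naw] /= := boolP (away w a b).
  by rewrite nE // andbT andbF !addn0.
rewrite andbF andbT add0n; have [av | nav] := boolP (away v a b).
  have [avw | navw] := boolP (away a v w).
    have [<- <-] := crossing_edge ab vw avw av naw.
    by rewrite !eqxx /away dist_refl.
  case: andP => [[/eqP E _] | _].
    by rewrite E away_edge in navw.
  have [bvw|//] := boolP (away b v w); move: naw;
    rewrite -(away_sym _ ab) => bw.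
  by have := away_upstream ba vw bvw bw; rewrite (away_sym _ ab) av.
case: andP => [[/eqP E _] | _]; first by rewrite -E away_edge in nav.
by rewrite addn0 parallel // (away_sym _ ab).
Qed.

End SummandCombinatorics.

(** * Finite families of vectors *)

Section Families.
Variables (kappa : fieldType) (J : finType).
Implicit Types (V : vectType kappa) (P : pred J).

Lemma linfunE V (V' : vectType kappa) (g : V -> V') : linear g -> linfun g =1 g.
Proof.
move=> lin_g x.
pose g' := GRing.isLinear.Build kappa V V' *:%R g lin_g.
pose gl : {linear V -> V'} := HB.pack g g'.
exact: (lfunE gl).
Qed.

(** The relation runs over all of [J]: the families in use vanish off [P], so coefficients there are
    unconstrained. *)
Definition free_on V P (b : J -> V) : Prop :=
  forall c : J -> kappa, \sum_j c j *: b j = 0 -> forall j, P j -> c j = 0.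

Definition generates V (U : {vspace V}) (b : J -> V) : Prop :=
  (forall j, b j \in U) /\
  forall y, y \in U -> exists c : J -> kappa, y = \sum_j c j *: b j.

(** A pseudo-inverse of the combination map of [b] chooses coefficients; two choices differ by a
    relation among the [b j], which the [b' j] satisfy as well. *)
Lemma linear_extension V (V' : vectType kappa) (b : J -> V) (b' : J -> V') :
  (forall c : J -> kappa, \sum_j c j *: b j = 0 -> \sum_j c j *: b' j = 0) ->
  exists phi : 'Hom(V, V'), forall j, phi (b j) = b' j.
Proof.
move=> ker.
pose psi (X : vectType kappa) (a : J -> X) (c : {ffun J -> kappa^o}) :=
  \sum_j c j *: a j.
have psi_lin X a : linear (@psi X a).
  move=> k c d; rewrite /psi scaler_sumr -big_split; apply: eq_bigr => j _.
  by rewrite !ffunE scalerDl scalerA.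
pose Psi X a := linfun (@psi X a).
have PsiE X a c : Psi X a c = \sum_j c j *: a j by rewrite linfunE.
exists (Psi _ b' \o (Psi _ b)^-1)%VF => j.
pose dj : {ffun J -> kappa^o} := [ffun i => (i == j)%:R].
have dE X a : Psi X a dj = a j.
  rewrite PsiE (bigD1 j) //= ffunE eqxx scale1r big1 ?addr0 // => i ij.
  by rewrite ffunE (negPf ij) scale0r.
rewrite comp_lfunE -[in LHS](dE _ b) -[RHS]dE; apply/eqP.
rewrite -subr_eq0 -linearB /=; set x := _ - dj; rewrite PsiE; apply/eqP.
apply: (ker (fun i => x i)); rewrite -PsiE.
by rewrite linearB /= limg_lfunVK ?memv_img ?memvf // subrr.
Qed.

Lemma sum_on V P (b : J -> V) (c : J -> kappa) :
  (forall j, ~~ P j -> b j = 0) ->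
  \sum_j c j *: b j = \sum_(j in P) c j *: b j.
Proof.
move=> b0; rewrite [RHS]big_mkcond; apply: eq_bigr => j _.
by case: ifPn => [//|/b0 ->]; rewrite scaler0.
Qed.

Lemma free_image V P (b : J -> V) : (forall j, ~~ P j -> b j = 0) ->
  free [seq b j | j in P] <-> free_on P b.
Proof.
move=> b0; have nthE (i : 'I_#|P|) : (image_tuple b P)`_i = b (enum_val i).
  exact: nth_image.
split=> [/(@freeP _ _ _ (image_tuple b P)) fr c | fr].
  rewrite (sum_on c b0) big_enum_val /= => c0 j Pj.
  have jP : j \in P := Pj; rewrite -(enum_rankK_in jP jP).
  apply: (fr (fun i => c (enum_val i))).
  by rewrite -[RHS]c0; apply: eq_bigr => i _; rewrite nthE.
apply/(@freeP _ _ _ (image_tuple b P)) => k k0 i.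
pose c j := oapp k 0 [pick i' | enum_val i' == j].
have cE i' : c (enum_val i') = k i'.
  rewrite /c; case: pickP => [i'' /eqP /enum_val_inj -> // | /(_ i')].
  by rewrite eqxx.
rewrite -cE; apply: fr; last exact: enum_valP.
rewrite (sum_on c b0) big_enum_val /= -[RHS]k0.
by apply: eq_bigr => i' _; rewrite nthE cE.
Qed.

Lemma span_image V (U : {vspace V}) P (b : J -> V) :
  (forall j, ~~ P j -> b j = 0) ->
  generates U b -> <<[seq b j | j in P]>>%VS = U.
Proof.
move=> b0 [bU genU]; apply/eqP; rewrite eqEsubv; apply/andP; split.
  by apply/span_subvP => _ /fintype.imageP [j _ ->].
apply/subvP => y /genU [c ->]; rewrite (sum_on c b0).
apply: memv_suml => j Pj; apply/memvZ/memv_span.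
exact: fintype.image_f.
Qed.

Lemma dim_family V (U : {vspace V}) P (b : J -> V) :
  (forall j, ~~ P j -> b j = 0) ->
  generates U b -> free_on P b -> \dim U = (\sum_j P j)%N.
Proof.
move=> b0 gU /(free_image b0) fr; rewrite -(span_image b0 gU).
by rewrite (eqP fr) size_image -sum1_card [LHS]big_mkcond.
Qed.

Lemma free_family V (U : {vspace V}) P (b : J -> V) :
  (forall j, ~~ P j -> b j = 0) ->
  generates U b -> (\sum_j P j <= \dim U)%N -> free_on P b.
Proof.
move=> b0 gU le; apply/(free_image b0).
apply: (@basis_free _ _ U); rewrite basisEdim (span_image b0 gU) subvv /=.
by rewrite size_image -sum1_card big_mkcond.
Qed.

End Families.

(** Corresponding fibres have equal size, so the k-th element of one is sent to the k-th element of
    the other. *)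
Lemma fiber_bijection (J J' : finType) (C : eqType) (t : J -> C) (t' :
  J' -> C) :
  (forall c, \sum_j (t j == c) = \sum_j (t' j == c))%N ->
  exists (h : J -> J') (g : J' -> J),
    [/\ cancel h g, cancel g h & forall j, t' (h j) = t j].
Proof.
pose fib (K : finType) (s : K -> C) c := enum [pred k | s k == c].
pose m (K K' : finType) (s : K -> C) (s' : K' -> C) k0' k :=
  nth k0' (fib _ s' (s k)) (index k (fib _ s (s k))).
have fibE (K : finType) (s : K -> C) c :
  size (fib _ s c) = (\sum_k (s k == c))%N.
  by rewrite -cardE -sum1_card big_mkcond.
have mem_fib (K : finType) (s : K -> C) k : k \in fib _ s (s k).
  by rewrite mem_enum inE.
have main (K K' : finType) (s : K -> C) (s' : K' -> C) k0 k0' :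
    (forall c, \sum_k (s k == c) = \sum_k (s' k == c))%N ->
    cancel (m K K' s s' k0') (m K' K s' s k0) /\
    forall k, s' (m K K' s s' k0' k) = s k.
  move=> cnt; have lt k : (index k (fib _ s (s k)) < size (fib _ s' (s k)))%N.
    by rewrite fibE -cnt -fibE index_mem mem_fib.
  have E k : s' (m K K' s s' k0' k) = s k.
    by apply/eqP; have := mem_nth k0' (lt k); rewrite mem_enum inE.
  split=> // k; rewrite {1}/m E /m index_uniq ?lt ?enum_uniq //.
  exact: (nth_index _ (mem_fib _ _ _)).
have empty (K K' : finType) (s : K -> C) (s' : K' -> C) :
    (forall c, \sum_k (s k == c) =
      \sum_k (s' k == c))%N -> K' =i pred0 -> K -> False.
  move=> cnt K'0 k; have := cnt (s k).
  by rewrite (bigD1 k) //= eqxx [RHS]big1 // => k'; have := K'0 k'; rewrite inE.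
move=> cnt;
  have cnt' c : (\sum_j (t' j == c) = \sum_j (t j == c))%N by rewrite cnt.
(* [nth] needs a default element, so empty index sets are handled apart. *)
have [j0 _|J0] := pickP (xpredT : pred J); last first.
  have F (j : J) : False by have := J0 j.
  have F' : J' -> False by apply: empty cnt' _ => j; have := J0 j.
  by exists (fun j => match F j with end), (fun j => match F' j with end);
    split=> j;
     [have := F j | have := F' j | have := F j].
have [j0' _|J0'] := pickP (xpredT : pred J'); last first.
  by have := empty _ _ _ _ cnt _ j0; case=> j; have := J0' j.
have [c1 E1] := main _ _ _ _ j0 j0' cnt;
  have [c2 E2] := main _ _ _ _ j0' j0 cnt'.
by exists (m J J' t t' j0'), (m J' J t' t j0).
Qed.

(** * Adapted bases and multiplicities *)

Section AdaptedBases.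
Variables (kappa : fieldType) (I : finType) (T : rel I).
Implicit Types (Q : qrep kappa T) (m : summand T -> nat) (c : summand T).

(* The nonzero vectors [b v j], for a fixed [v], form a basis of [Q v]; for a
   fixed [j] they span a copy of the representation designated by [t j]. *)
Definition adapted Q (J : finType) (t : J -> summand T)
    (b : forall v, J -> Q v) : Prop :=
  [/\ forall v, generates fullv (b v),
      forall v, free_on (fun j => support (t j) v) (b v),
      forall v j, ~~ support (t j) v -> b v j = 0
    & forall (e : oedge T) j, qmap Q e (b (source e) j) =
        if away T (origin (t j)) (source e) (target e) then b (target e) j
          else 0].

(** Stands for an isomorphism with the direct sum of the summands [c], each taken [m c] times,
    without forming that sum. *)
Definition has_multiplicities Q m : Prop :=
  exists (J : finType) (t : J -> summand T) (b : forall v, J -> Q v),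
    adapted t b /\ forall c, (\sum_j (t j == c))%N = m c.

Lemma has_multiplicities_ext Q m m' :
  m =1 m' -> has_multiplicities Q m -> has_multiplicities Q m'.
Proof. by move=> E [J [t [b [ad cnt]]]]; exists J, t, b; split=> // c;
  rewrite cnt. Qed.

Lemma qiso_sym Q Q' : qiso Q Q' -> qiso Q' Q.
Proof.
move=> [phi [bij com]].
have ker0 v : lker (phi v) == 0%VS by apply/lker0P/bij_inj.
have phiVK v : cancel (phi v)^-1%VF (phi v).
  by apply/(bij_can_sym (bij v)); apply: lker0_lfunK.
exists (fun v => (phi v)^-1%VF); split=> [v | e x].
  by exists (phi v) => //; apply: lker0_lfunK.
apply: (bij_inj (bij (target e))).
by rewrite com !phiVK.
Qed.

Lemma has_multiplicities_iso Q Q' m :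
  qiso Q Q' -> has_multiplicities Q m -> has_multiplicities Q' m.
Proof.
move=> [phi [bij com]] [J [t [b [[gen fr b0 tr] cnt]]]].
exists J, t, (fun v j => phi v (b v j)); split=> //; split.
- move=> v; split=> [j | y _]; first exact: memvf.
  have [psi psiK phiK] := bij v.
  have [d /(congr1 (phi v))] := (gen v).2 (psi y) (memvf _).
  rewrite phiK linear_sum => ->; exists d.
  by apply: eq_bigr => j _; rewrite linearZ.
- move=> v d d0; apply: fr; apply: (bij_inj (bij v)).
  rewrite linear0 -[RHS]d0 linear_sum.
  by apply: eq_bigr => j _; rewrite linearZ.
- by move=> v j /b0 ->; rewrite linear0.
- by move=> e j; rewrite -com tr; case: ifP => //; rewrite linear0.
Qed.

(** The adapted bases are matched along a type-preserving bijection of their index sets; the arrow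
    rule in [adapted] depends on the type only. *)
Lemma qiso_multiplicities Q Q' m :
  has_multiplicities Q m -> has_multiplicities Q' m -> qiso Q Q'.
Proof.
move=> [J [t [b [[gen fr b0 tr] cnt]]]] [J' [t' [b' [[gen' fr' b0' tr']
  cnt']]]].
have [h [g [hK gK th]]] : exists (h : J -> J') (g : J' -> J),
    [/\ cancel h g, cancel g h & forall j, t' (h j) = t j].
  by apply: fiber_bijection => c; rewrite cnt cnt'.
have tg j : t (g j) = t' j by rewrite -th gK.
have phiP v : exists phi : 'Hom(Q v, Q' v), forall j, phi (b v j) = b' v (h j).
  apply: linear_extension => c c0; rewrite big1 // => j _.
  have [sj | nsj] := boolP (support (t j) v);
    first by rewrite (fr v c) ?scale0r.
  by rewrite b0' ?scaler0 ?th.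
have psiP v : exists psi : 'Hom(Q' v, Q v), forall j, psi (b' v j) = b v (g j).
  apply: linear_extension => c c0; rewrite big1 // => j _.
  have [sj | nsj] := boolP (support (t' j) v);
    first by rewrite (fr' v c) ?scale0r.
  by rewrite b0 ?scaler0 ?tg.
pose phi v := projT1 (cid (phiP v)); pose psi v := projT1 (cid (psiP v)).
have phiE v j : phi v (b v j) = b' v (h j) by apply: (projT2 (cid (phiP v))).
have psiE v j : psi v (b' v j) = b v (g j) by apply: (projT2 (cid (psiP v))).
have ext (X Y : vectType kappa) (K : finType) (a : K -> X) (k k' : 'Hom(X, Y)) :
    generates fullv a -> (forall j, k (a j) = k' (a j)) -> k =1 k'.
  move=> [_ ga] E y; have [d ->] := ga y (memvf _).
  by rewrite !linear_sum; apply: eq_bigr => j _; rewrite !linearZ /= E.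
exists phi; split=> [v | e x].
  exists (psi v) => x.
    rewrite -comp_lfunE -[RHS]id_lfunE; apply: ext (gen v) _ x => j.
    by rewrite comp_lfunE phiE psiE hK id_lfunE.
  rewrite -comp_lfunE -[RHS]id_lfunE; apply: ext (gen' v) _ x => j.
  by rewrite comp_lfunE psiE phiE gK id_lfunE.
rewrite -!comp_lfunE; apply: ext (gen _) _ x => j.
by rewrite !comp_lfunE tr phiE tr' th; case: ifP; rewrite ?phiE ?linear0.
Qed.

Lemma sum_fibers (J : finType) (t : J -> summand T) (F : summand T -> nat) m :
  (forall c, (\sum_j (t j == c))%N = m c) ->
  (\sum_j F (t j) = \sum_c m c * F c)%N.
Proof.
move=> cnt; under [RHS]eq_bigr do rewrite -cnt big_distrl /=.
rewrite exchange_big; apply: eq_bigr => j _.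
rewrite (bigD1 (t j)) //= eqxx mul1n big1 ?addn0 // => c.
by rewrite eq_sym => /negPf ->.
Qed.

Lemma has_multiplicities_zero : has_multiplicities (qzero kappa T) (fun=> 0%N).
Proof.
exists void, (fun j : void => match j with end), (fun v (j : void) =>
  match j with end).
split=> [|c]; last by rewrite big1 // => -[].
split=> [v | v c _ [] | v [] | e []] //; split=> [[]|y _].
by exists (fun j : void => match j with end); rewrite [y]thinmx0 big1 // => -[].
Qed.

Lemma has_multiplicities_sum Q Q' m m' :
  has_multiplicities Q m -> has_multiplicities Q' m' ->
  has_multiplicities (qsum Q Q') (fun c => m c + m' c)%N.
Proof.
move=> [J [t [b [[gen fr b0 tr] cnt]]]] [J' [t' [b' [[gen' fr' b0' tr']
  cnt']]]].
pose tt (j : J + J') := match j with inl j => t j | inr j => t' j end.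
pose bb v (j : J + J') : qsum Q Q' v :=
  match j with inl j => (b v j, 0) | inr j => (0, b' v j) end.
exists (J + J')%type, tt, bb; split=> [|c]; last first.
  by rewrite big_sumType /= cnt cnt'.
have sumE v (c : J + J' -> kappa) : \sum_j c j *: bb v j =
    (\sum_j c (inl j) *: b v j, \sum_j c (inr j) *:
      b' v j) :> (Q v * Q' v)%type.
  rewrite big_sumType /=; apply: injective_projections => /=.
    rewrite !(big_morph (@fst (Q v) (Q' v)) (fun _ _ => erefl) erefl) /=.
    by rewrite [X in _ + X]big1 ?addr0 // => j _; rewrite scaler0.
  rewrite !(big_morph (@snd (Q v) (Q' v)) (fun _ _ => erefl) erefl) /=.
  by rewrite big1 ?add0r // => j _; rewrite scaler0.
split.
- move=> v; split=> [j | y _]; first exact: memvf.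
  have [d Ed] := (gen v).2 y.1 (memvf _);
    have [d' Ed'] := (gen' v).2 y.2 (memvf _).
  exists (fun j => match j with inl j => d j | inr j => d' j end).
  by rewrite sumE -Ed -Ed'; case: y {Ed Ed'}.
- move=> v c; rewrite sumE => -[E E'] [j|j]; first exact: (fr v (c \o inl)).
  exact: (fr' v (c \o inr)).
- by move=> v [j|j] /= ns; rewrite ?b0 ?b0'.
move=> e j; rewrite /= linfunE => [|k x y]; last first.
  by rewrite !linearP.
by case: j => j /=; rewrite linear0 ?tr ?tr'; case: ifP.
Qed.

Lemma has_multiplicities_pow Q m k :
  has_multiplicities Q m -> has_multiplicities (qpow Q k) (fun c => k * m c)%N.
Proof.
move=> Qm; elim: k => [|k IH]; first exact: has_multiplicities_zero.
apply: (@has_multiplicities_ext _ (fun c => m c + k * m c)%N) => [c|].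
  by rewrite mulSn.
exact: has_multiplicities_sum.
Qed.

Lemma has_multiplicities_bigsum (J : finType) (P : pred J)
    (Q : J -> qrep kappa T) (m : J -> summand T -> nat) :
  (forall j, has_multiplicities (Q j) (m j)) ->
  has_multiplicities (qbigsum P Q) (fun c => \sum_(j | P j) m j c)%N.
Proof.
move=> Qm; rewrite /qbigsum; elim: (index_enum J) => [|j r IH].
  rewrite big_nil; apply: has_multiplicities_ext has_multiplicities_zero => c.
  by rewrite big_nil.
rewrite big_cons; case: ifP => Pj; last first.
  by apply: has_multiplicities_ext IH => c; rewrite big_cons Pj.
apply: has_multiplicities_ext (has_multiplicities_sum (Qm j) IH) => c.
by rewrite big_cons Pj.
Qed.

(** An arrow sends a basis vector to the vector of the same index or to zero, so the nonzero images
    remain independent. *)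
Lemma rank_multiplicities Q m (e : oedge T) : has_multiplicities Q m ->
  \dim (limg (qmap Q e)) =
  (\sum_c m c * transmits c (source e) (target e))%N.
Proof.
move=> [J [t [b [[gen fr b0 tr] cnt]]]].
rewrite -(sum_fibers (fun c => transmits c (source e) (target e) : nat) cnt).
apply: (@dim_family _ _ _ _ _ (fun j => qmap Q e (b (source e) j))).
- move=> j; rewrite tr /transmits; case: ifP => //= _; exact: b0.
- split=> [j | _ /memv_imgP [x _ ->]]; first by rewrite memv_img ?memvf.
  have [d ->] := (gen (source e)).2 x (memvf _); exists d.
  by rewrite linear_sum; apply: eq_bigr => j _; rewrite linearZ.
move=> c c0 j /andP[aw sj].
pose d i := if away T (origin (t i)) (source e) (target e) then c i else 0.
have <- : d j = c j by rewrite /d aw.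
apply: (fr (target e)) sj; rewrite -[RHS]c0; apply: eq_bigr => i _.
by rewrite tr /d; case: ifP; rewrite ?scale0r ?scaler0.
Qed.

End AdaptedBases.

Section AdaptedSummands.
Variables (kappa : fieldType) (I : finType) (T : rel I).
Variables (W : I -> vectType kappa) (f : forall i j, 'Hom(W i, W j)).
Hypothesis H : transition_system T f.

Lemma has_multiplicities_P u :
  has_multiplicities (P_rep kappa T u) (fun c => (c == inl u) : nat).
Proof.
exists unit, (fun=> inl u), (fun _ _ => 1); split=> [|c]; last first.
  by rewrite (bigD1 tt) //= big1 ?addn0 1?eq_sym // => -[].
split=> [v | v c | // | e j /=].
- split=> [j|y _]; first exact: memvf.
  by exists (fun=> y);
    rewrite (bigD1 tt) //= big1 ?addr0 ?[_ *: _]mulr1 // => -[].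
- by rewrite (bigD1 tt) //= big1 ?addr0 ?[_ *: _]mulr1 => [c0 []|[]].
- rewrite (mem_branch H) /away; case: ifP => _; first by rewrite id_lfunE.
  by rewrite zero_lfunE.
Qed.

Lemma has_multiplicities_R (i : oedge T) :
  has_multiplicities (R_rep kappa i) (fun c => (c == inr i) : nat).
Proof.
have row_bool (a : bool) (y : 'rV[kappa]_a) : exists k, y = k *: const_mx 1.
  case: a y => y; last by exists 0; rewrite !thinmx0.
  by exists (y 0 0); apply/rowP => j; rewrite !mxE ord1 mulr1.
have row_free (a : bool) (k : kappa) : a -> k *:
  const_mx 1 = 0 :> 'rV_a -> k = 0.
  by case: a => // _ /rowP /(_ 0); rewrite !mxE mulr1.
have row_map (a a' : bool) : a -> a' ->
    (const_mx 1 : 'rV[kappa]_a) *m pid_mx 1 = const_mx 1 :> 'rV_a'.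
  case: a a' => -[] // _ _; apply/rowP => j.
  by rewrite !mxE big_ord1 !mxE !ord1 mul1r.
have suppE v : support (inr i : summand T) v = (v \in branch i).
  by rewrite (mem_branch H).
exists unit, (fun=> inr i), (fun _ _ => const_mx 1); split=> [|c]; last first.
  by rewrite (bigD1 tt) //= big1 ?addn0 1?eq_sym // => -[].
split=> [v | v c | v _ | e j].
- split=> [j|y _]; first exact: memvf.
  have [k Ek] := row_bool _ y; exists (fun=> k).
  by rewrite (bigD1 tt) //= big1 ?addr0 // => -[].
- rewrite suppE (bigD1 tt) //= big1 ?addr0 => [c0 [] vi|[]] //.
  exact: row_free c0.
- by rewrite suppE => /negPf E; rewrite /=; move: (const_mx _);
  rewrite E => y; apply: thinmx0.
rewrite /= (mem_branch H (source i)) -/(away _ _ _ _).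
case: (boolP (away T (source i) (source e) (target e))) => aw; last first.
  by rewrite !andbF zero_lfunE.
rewrite andbT; have := oedgeP i; have := oedgeP e => yz ab.
(* [R_rep] tests both ends; for an outward arrow the far end decides, and off the branch the target
   space is zero. *)
have up : target e \in branch i -> source e \in branch i.
  by rewrite -!suppE; apply: (away_upstream H ab yz aw).
case: (boolP (target e \in branch i)) => te.
  rewrite up //= linfunE => [|k x y]; last by rewrite linearP.
  exact: (row_map true true).
rewrite andbF zero_lfunE; apply/esym.
exact: thinmx0.
Qed.

End AdaptedSummands.

(** * Decomposition of subrepresentations *)

Lemma generates_span (kappa : fieldType) (V : vectType kappa) (J : finType)
    (b : J -> V) : generates <<[seq b j | j : J]>>%VS b.
Proof.
split=> [j | y]; first by apply/memv_span/fintype.image_f.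
move/(@coord_span _ _ _ (image_tuple b J)) => ->.
exists (fun j => coord (image_tuple b J) (enum_rank j) y).
rewrite [RHS](eq_bigl (mem J)) // [RHS]big_enum_val.
by apply: eq_bigr => i _; rewrite enum_valK nth_image.
Qed.

Section Classification.
Variables (kappa : fieldType) (I : finType) (T : rel I).
Variables (W : I -> vectType kappa) (f : forall i j, 'Hom(W i, W j)).
Hypothesis H : transition_system T f.
Implicit Types (u v w z : I) (c : summand T).
Local Notation dist := (dist T).
Local Notation away := (away T).

Let symT := ts_sym H.
Let conn := ts_conn H.

(* Both recursions express [r w v] through the [r z w] with [z] in the smaller
   branch behind [w]. *)
Lemma flow_unique (D D' g : I -> nat) (r r' h : I -> I -> nat) :
  (forall v, D v = g v + \sum_(w | T v w) (h v w + r w v))%N ->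
  (forall v w, T v w -> D v = h v w + r w v + r v w)%N ->
  (forall v, D' v = g v + \sum_(w | T v w) (h v w + r' w v))%N ->
  (forall v w, T v w -> D' v = h v w + r' w v + r' v w)%N ->
  D =1 D'.
Proof.
move=> Dv De D'v D'e.
suff rr' w v : T w v -> r w v = r' w v.
  move=> v; rewrite Dv D'v; congr addn; apply: eq_bigr => w vw.
  by rewrite rr' // symT.
move: {2}(#|[pred u | away u w v]|).+1 (ltnSn #|[pred u | away u w v]|) => k.
elim: k w v => // k IH w v; rewrite ltnS => lek wv.
have := De _ _ wv; have := D'e _ _ wv; rewrite Dv D'v.
(* The unknown [r v w] occurs in both expressions for [D w] and cancels, leaving terms [r z w] with
   [z != v]. *)
rewrite (bigD1 v wv) [in X in _ -> X -> _](bigD1 v wv) /=.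
have -> : (\sum_(z | T w z && (z != v)) (h w z + r z w) =
           \sum_(z | T w z && (z != v)) (h w z + r' z w))%N.
  apply: eq_bigr => z /andP[wz zv]; rewrite IH //; last by rewrite symT.
  apply: leq_trans lek; apply: proper_card; apply/fintype.properP; split.
    apply/fintype.subsetP => u; rewrite !inE => /eqP uw.
    apply: contraNT zv; rewrite -(away_sym H) // => /eqP uw'.
    by rewrite (dist_pred_unique H (u := u) (v := w) (w := z) (w' := v)) //
      symT.
  exists w; rewrite inE ?(away_edge H) //.
  by rewrite /away dist_refl.
by move=> /eqP; rewrite -!addnA; move=> /eqP ? ?; lia.
Qed.

Variable U : subspaces (config_rep T f).
Hypothesis subU : is_subrep U.

Lemma subrep_edge w v : T w v -> (f w v @: U w <= U v)%VS.
Proof.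
by move=> wv; apply: (subU (exist (fun e : I * I => T e.1 e.2) (w, v) wv)).
Qed.

Lemma subrep_transition u v : (f u v @: U u <= U v)%VS.
Proof.
move: {2}(dist u v) (erefl (dist u v)) => k; elim: k v => [|k IH] v duv.
  by rewrite (dist_eq0 conn duv) (ts_refl H) lim1g.
have [w wv dw] : exists2 w, T w v & dist u v = (dist u w).+1.
  by apply: (dist_pred conn); apply/eqP => uv; rewrite uv dist_refl in duv.
rewrite -(transition_geodesic H wv dw) limg_comp.
apply: subv_trans (subrep_edge wv); apply/limgS/IH; lia.
Qed.

(** [G u] will generate the copies of [P_u], and [Hk u w] those of [R_(u,w)]: it complements, in the
    kernel [K u w], what already arrives from [w]. *)
Let K u w : {vspace W u} := (U u :&: lker (f u w))%VS.
Let Hk u w : {vspace W u} := (K u w :\: f w u @: U w)%VS.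
Let G u : {vspace W u} := (U u :\: \sum_(w | T u w) K u w)%VS.

Let Gen c : {vspace W (origin c)} :=
  match c with inl u => G u | inr e => Hk (source e) (target e) end.

Lemma image_sub_kernel u w : T u w -> (f w u @: U w <= K u w)%VS.
Proof.
move=> uw; have wu : T w u by rewrite symT.
by rewrite subv_cap subrep_edge //= lkerE -limg_comp (transition_back H) ?lim0g.
Qed.

Lemma kernel_split u w : T u w -> (K u w = Hk u w + f w u @: U w)%VS.
Proof. by move=> uw; rewrite addv_diff;
  apply/esym/addv_idPl/image_sub_kernel. Qed.

Lemma vertex_split u : (U u = G u + \sum_(w | T u w) K u w)%VS.
Proof.
rewrite addv_diff; apply/esym/addv_idPl/subv_sumP => w _.
exact: capvSl.
Qed.

Lemma dim_kernel u w :
  T u w -> \dim (K u w) = (\dim (Hk u w) + \dim (f w u @: U w))%N.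
Proof. by move=> uw;
  rewrite {1}kernel_split // dimv_disjoint_sum // capv_diff. Qed.

(** Local linear independence enters here: [K u w] lies in [lker (f u w) = limg (f w u)], so the sum
    of the kernels is direct. *)
Lemma dim_vertex u :
  \dim (U u) = (\dim (G u) + \sum_(w | T u w) \dim (K u w))%N.
Proof.
rewrite {1}vertex_split dimv_disjoint_sum ?capv_diff //; congr addn.
apply/eqP; rewrite -[_ == _]/(directv (\sum_(w | T u w) K u w)).
apply/directv_sum_independent => us usK us0 w uw.
have /directv_sum_independent ind := ts_direct H u.
apply: (ind us) => //; last by rewrite symT.
  move=> z zu; have uz : T u z by rewrite symT.
  by rewrite -(ts_ker H) //; have := usK z uz; rewrite memv_cap => /andP[].
by rewrite -[RHS]us0; apply: eq_bigl => z; rewrite symT.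
Qed.

(** [U u] consists of new generators and of images of the neighbouring [U w]. After [f u v] such an
    image vanishes, unless [w] is farther from [v] than [u]; distances are bounded, so the tracing
    back stops. *)
Lemma generators_span u v :
  (f u v @: U u <= \sum_c f (origin c) v @: Gen c)%VS.
Proof.
move: {2}(#|I| - dist u v).+1 (ltnSn (#|I| - dist u v)) => k.
elim: k u => // k IH u; rewrite ltnS => lek.
rewrite vertex_split limgD subv_add; apply/andP; split.
  exact: (sumv_sup (inl u)).
rewrite limg_sum; apply/subv_sumP => w uw;
  rewrite kernel_split // limgD subv_add.
apply/andP; split.
  exact: (sumv_sup (inr (exist (fun e : I * I => T e.1 e.2) (u, w) uw))).
rewrite -limg_comp (transition_edge_l H) ?(symT w u) //.
case: eqP => dw; last by rewrite lim0g sub0v.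
by apply: IH; have := dist_le_card T w v; lia.
Qed.

(** The transported generators span [U v], and those supported at [v] are as many as [\dim (U v)],
    because both numbers satisfy the recursions of [flow_unique]. A spanning family of that size is
    free. *)
Lemma subrep_has_multiplicities :
  exists m, has_multiplicities (subrep U) m.
Proof.
exists (fun c => \dim (Gen c)).
pose J : finType := {c : summand T & 'I_(\dim (Gen c))}.
pose g (j : J) : W (origin (tag j)) := (vbasis (Gen (tag j)))`_(tagged j).
pose b v (j : J) := f (origin (tag j)) v (g j).
have gGen (j : J) : g j \in Gen (tag j).
  by apply/vbasis_mem/mem_nth; rewrite size_tuple.
have GenU c : (Gen c <= U (origin c))%VS.
  case: c => [u|e]; first exact: diffvSl.
  exact: subv_trans (diffvSl _ _) (capvSl _ _).
have bU v j : b v j \in U v.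
  apply: (subvP (subrep_transition (origin (tag j)) v)).
  exact/memv_img/(subvP (GenU _)).
(* A generator of [R_e] is killed by [f_e], and off [A_e] the map from its source factors through
   [f_e]. *)
have b0 v j : ~~ support (tag j) v -> b v j = 0.
  rewrite /b; move: (gGen j); case: (tag j) (g j) => [u|e] //= x xK.
  rewrite -(away_sym H v (oedgeP e)) => /eqP;
    rewrite !(dist_sym conn symT v) => dv.
  rewrite -(transition_geodesic_l H (oedgeP e) dv) comp_lfunE.
  have /(subvP (diffvSl _ _)) := xK;
    rewrite memv_cap memv_ker => /andP[_ /eqP ->].
  exact: linear0.
have genb v : generates (U v) (b v).
  split=> [j|y yU]; first exact: bU.
  have [_] := generates_span (b v); apply.
  have : y \in (f v v @: U v)%VS by rewrite (ts_refl H) lim1g.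
  move/(subvP (generators_span v v)); apply/subvP/subv_sumP => c _.
  rewrite -{1}(span_basis (vbasisP (Gen c))) limg_span.
  apply/span_subvP => _ /mapP [x xb ->].
  have lt : (index x (vbasis (Gen c)) < \dim (Gen c))%N.
    by rewrite -[X in (_ < X)%N](size_tuple (vbasis (Gen c))) index_mem.
  apply/memv_span; rewrite -(nth_index 0 xb).
  exact: (fintype.image_f (b v) (x := Tagged _ (Ordinal lt) : J)).
have sumJ (F : summand T -> nat) :
    (\sum_(j : J) F (tag j) = \sum_c \dim (Gen c) * F c)%N.
  rewrite -(sig_big_dep (fun=> true) (fun _ _ =>
    true) (fun c (_ : 'I_(\dim (Gen c))) => F c)) /=.
  by apply: eq_bigr => c _; rewrite sum_nat_const card_ord.
have kerE v w :
  T v w -> (\sum_c \dim (Gen c) * kernel_at c v w = \dim (Hk v w))%N.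
  move=> vw; pose e : oedge T := exist (fun e : I * I => T e.1 e.2) (v, w) vw.
  rewrite (bigD1 (inr e)) //= eqxx muln1 big1 ?addn0 // => -[u|e'] //= ne.
    by rewrite muln0.
  case: eqP => [E|]; last by rewrite muln0.
  by case/eqP: ne; congr inr; apply: val_inj.
have dimE v : \dim (U v) = (\sum_c \dim (Gen c) * support c v)%N.
  pose r w v := (\sum_c \dim (Gen c) * transmits c w v)%N.
  pose rho w v := \dim (f w v @: U w).
  pose D' u := (\sum_c \dim (Gen c) * support c u)%N.
  rewrite -[RHS]/(D' v); move: v.
  apply: (@flow_unique (fun v => \dim (U v)) D' (fun v => \dim (G v)) rho r
            (fun v w => \dim (Hk v w))) => v.
  - by rewrite dim_vertex; congr addn; apply: eq_bigr => w; apply: dim_kernel.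
  - by move=> w vw; rewrite -dim_kernel // -(limg_ker_dim (f v w) (U v)).
  - rewrite /D';
    under eq_bigr do rewrite (support_vertex H) mulnDr big_distrr /=.
    rewrite big_split /= exchange_big /=; congr addn.
      rewrite (bigD1 (inl v)) //= eqxx muln1 big1 ?addn0 // => c.
      by move=> /negPf ->; rewrite muln0.
    apply: eq_bigr => w vw; rewrite -kerE // -big_split /=.
    by apply: eq_bigr => c _; rewrite mulnDr.
  move=> w vw; rewrite /D';
    under eq_bigr do rewrite (support_edge H _ vw) !mulnDr.
  by rewrite !big_split /= kerE.
exists J, (fun j => tag j), (fun v j => vsproj (U v) (b v j)); split;
  last first.
  move=> c; rewrite (sumJ (fun c' => (c' == c) : nat)) (bigD1 c) //= eqxx muln1.
  by rewrite big1 ?addn0 // => c' /negPf ->; rewrite muln0.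
have sumE v (d : J -> kappa) :
    vsval (\sum_j d j *: vsproj (U v) (b v j)) = \sum_j d j *: b v j.
  rewrite linear_sum; apply: eq_bigr => j _.
  by rewrite linearZ /= vsprojK ?bU.
split.
- move=> v; split=> [j | y _]; first exact: memvf.
  have [d Ed] := (genb v).2 (vsval y) (subvsP y).
  by exists d; apply: subvs_inj; rewrite sumE.
- move=> v d d0; apply: (free_family (b := b v) (b0 v) (genb v)).
    by rewrite (sumJ (fun c => support c v : nat)) -dimE.
  by rewrite -sumE d0.
- by move=> v j /b0 ->; rewrite linear0.
move=> e j; rewrite /= linfunE => [|k x y]; last by rewrite !linearP.
rewrite vsprojK ?bU // -comp_lfunE (transition_edge H _ (oedgeP e)) /away.
by case: ifP => //; rewrite zero_lfunE linear0.
Qed.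

End Classification.

(** * Pluecker coordinates along a line of families *)

(** Cauchy-Binet before collecting terms: [J] ranges over all functions, as in [pl_index], so no
    signs have to be tracked. *)
Lemma det_mul_expand (R : comNzRingType) (n d : nat)
    (A : 'M[R]_(n, d)) (G : 'M[R]_(d, n)) :
  \det (A *m G) = \sum_(J : {ffun 'I_n -> 'I_d})
    (\prod_b G (J b) b) * \det (\matrix_(a, b) A a (J b)).
Proof.
rewrite -det_tr {1}/determinant.
under eq_bigr => s _.
  under eq_bigr => b _ do rewrite !mxE.
  rewrite bigA_distr_bigA big_distrr /=; over.
rewrite exchange_big; apply: eq_bigr => J _.
rewrite -det_tr /determinant big_distrr; apply: eq_bigr => s _ /=.
rewrite mulrCA; congr (_ * _); rewrite -big_split; apply: eq_bigr => b _.
by rewrite !mxE mulrC.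
Qed.

Section Bases.
Variables (kappa : fieldType) (V : vectType kappa) (n : nat).
Implicit Types (X Y : n.-tuple V) (U : {vspace V}).

Lemma basis_change U X Y : basis_of U X -> basis_of U Y ->
  exists P : 'M[kappa]_n, \det P != 0 /\ forall a :
    'I_n, Y`_a = \sum_i P a i *: X`_i.
Proof.
move=> bX bY; pose P : 'M_n := \matrix_(a, i) coord X i Y`_a.
pose Q : 'M_n := \matrix_(a, i) coord Y i X`_a.
have YE (a : 'I_n) : Y`_a = \sum_i P a i *: X`_i.
  rewrite [LHS](coord_basis bX) ?(basis_mem bY) ?mem_nth ?size_tuple //.
  by apply: eq_bigr => i _; rewrite mxE.
exists P; split=> //.
suff PQ : P *m Q = 1%:M.
  apply: contra_neq (oner_neq0 kappa) => P0.
  by rewrite -(det1 kappa n) -PQ det_mulmx P0 mul0r.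
apply/matrixP => a b;
  rewrite !mxE -(coord_free a b (basis_free bY)) YE linear_sum.
by apply: eq_bigr => i _; rewrite linearZ /= !mxE.
Qed.

(* [q] is the determinant of the coordinates of [A + t B] with respect to [A]. *)
Lemma generic_free (A B : 'I_n -> V) : free (mktuple A) ->
  exists q :
    {poly kappa}, q.[0] = 1 /\
    forall t, q.[t] != 0 -> free (mktuple (fun a => A a + t *: B a)).
Proof.
move=> frA; pose g b := coord (mktuple A) b.
pose M : 'M[{poly kappa}]_n :=
  \matrix_(a, b) ((g b (A a))%:P + 'X * (g b (B a))%:P).
have ME t : (\det M).[t] = \det (\matrix_(a, b) g b (A a + t *: B a)).
  rewrite -horner_evalE -det_map_mx; congr (\det _); apply/matrixP => a b.
  by rewrite !mxE /= /horner_eval !hornerE /g linearD linearZ /=.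
exists (\det M); split.
  rewrite ME -[RHS](det1 kappa n); congr (\det _); apply/matrixP => a b.
  rewrite !mxE scale0r addr0 -(coord_free a b frA) /g.
  by rewrite nth_mktuple.
move=> t; rewrite ME => q0; apply/freeP => k k0 a.
have kM : (\row_a k a) *m (\matrix_(a, b) g b (A a + t *: B a)) = 0.
  apply/rowP => b; rewrite !mxE -[RHS](linear0 (g b)) -[in RHS]k0 linear_sum.
  by apply: eq_bigr => i _; rewrite !mxE nth_mktuple linearZ.
have U : \matrix_(a, b) g b (A a + t *:
  B a) \in unitmx by rewrite unitmxE unitfE.
have : \row_a k a = 0 by rewrite -[LHS](mulmxK U) kM mul0mx.
by move/rowP/(_ a); rewrite !mxE.
Qed.

End Bases.

Section Closure.
Variables (kappa : fieldType) (I : finType) (T : rel I) (W : qrep kappa T).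
Variable x : I -> nat.
Implicit Types (U : subspaces W) (k : pl_index W x).

Definition vector_family := forall v, 'I_(x v) -> W v.
Implicit Types Y : vector_family.

Definition family_minor Y k : kappa :=
  \det (\matrix_(a < x (tag k), b < x (tag k))
          coord (vbasis fullv) (tagged k b) (Y (tag k) a)).

Lemma pluecker_family U Y : (forall v, \dim (U v) = x v) ->
  (forall v, basis_of (U v) (mktuple (Y v))) ->
  exists lam : I -> kappa, (forall v, lam v != 0) /\
    forall k, pluecker U k = lam (tag k) * family_minor Y k.
Proof.
move=> dimU basY.
have change v : exists P : 'M[kappa]_(x v), \det P != 0 /\
    forall a : 'I_(x v), (vbasis (U v))`_a = \sum_i P a i *: Y v i.
  have sz : size (vbasis (U v)) == x v by rewrite size_tuple dimU.
  have [P [P0 PE]] := basis_change (Y := Tuple sz) (basY v) (vbasisP (U v)).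
  exists P; split=> // a; rewrite PE; apply: eq_bigr => i _.
  by rewrite nth_mktuple.
pose P v := projT1 (cid (change v)).
have PP v : \det (P v) != 0 /\
    forall a : 'I_(x v), (vbasis (U v))`_a = \sum_i P v a i *: Y v i.
  exact: (projT2 (cid (change v))).
exists (fun v => \det (P v)); split=> [v | k]; first by case: (PP v).
rewrite /pluecker /family_minor -det_mulmx; congr (\det _);
  apply/matrixP => a b.
rewrite !mxE (PP (tag k)).2 linear_sum; apply: eq_bigr => i _.
by rewrite linearZ !mxE.
Qed.

Lemma multihomogeneous_scale m (F : {mpoly kappa[#|{: pl_index W x}|]})
    (lam : I -> kappa) (h h' : pl_index W x -> kappa) :
  multihomogeneous m F -> (forall k, h k = lam (tag k) * h' k) ->
  F.@[fun i => h (enum_val i)] =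
  (\prod_v lam v ^+ m v) * F.@[fun i => h' (enum_val i)].
Proof.
move=> hom hE; rewrite !mevalE big_distrr /=; apply: eq_big_seq => mon monF.
rewrite mulrCA; congr (_ * _).
under eq_bigr do rewrite hE exprMn; rewrite big_split /=; congr (_ * _).
rewrite (partition_big (fun i => tag (enum_val i)) xpredT) //=.
apply: eq_bigr => v _; rewrite -(hom _ monF) expr_sum.
by apply: eq_bigr => i /eqP ->.
Qed.

(** Changing the basis of [U v] rescales all coordinates at [v] by one nonzero determinant, and a
    multihomogeneous polynomial by a nonzero factor; so any basis may replace [vbasis]. *)
Lemma pl_vanishes_family m (F : {mpoly kappa[#|{: pl_index W x}|]}) U Y :
  multihomogeneous m F -> (forall v, \dim (U v) = x v) ->
  (forall v, basis_of (U v) (mktuple (Y v))) ->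
  pl_vanishes F U <-> F.@[fun i => family_minor Y (enum_val i)] = 0.
Proof.
move=> hom dimU basY; have [lam [lam0 E]] := pluecker_family dimU basY.
rewrite /pl_vanishes (multihomogeneous_scale hom E).
split=> [/eqP | ->]; last by rewrite mulr0.
rewrite mulf_eq0 => /orP[|/eqP //]; rewrite prodf_seq_eq0 => /hasP [v _ /=].
by rewrite expf_eq0 (negPf (lam0 v)) andbF.
Qed.

End Closure.

(** * Closure points reached along lines of bases *)

Section Curves.
Variables (kappa : closedFieldType) (I : finType) (T : rel I) (W :
  qrep kappa T).
Variable x : I -> nat.
Implicit Types (A B : vector_family W x).

Definition line_family A B (t : kappa) : vector_family W x := fun v a =>
  A v a + t *: B v a.
Arguments line_family A B t v a : clear implicits.

Lemma generic_line A B : (forall v, free (mktuple (A v))) ->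
  exists2 q : {poly kappa}, q != 0 &
    forall t, q.[t] != 0 -> t != 0 /\
      forall v, free (mktuple (line_family A B t v)).
Proof.
move=> frA; pose q v := projT1 (cid (generic_free (B v) (frA v))).
have qP v : (q v).[0] = 1 /\ forall t, (q v).[t] != 0 ->
    free (mktuple (line_family A B t v)).
  exact: (projT2 (cid (generic_free (B v) (frA v)))).
(* The factor ['X] excludes [t = 0]; the other one takes the value 1 at 0, so the product is a
   nonzero polynomial. *)
exists ('X * \prod_v q v).
  rewrite mulf_neq0 ?polyX_eq0 //; apply/eqP => /(congr1 (horner^~ 0)) /eqP.
  rewrite horner_prod horner0; under eq_bigr do rewrite (qP _).1.
  by rewrite big1_eq oner_eq0.
move=> t; rewrite hornerM hornerX mulf_eq0 negb_or => /andP[t0 qt];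
  split=> // v.
apply: (qP v).2; move: qt; rewrite horner_prod; apply: contraNneq => qv.
by rewrite (bigD1 v) //= qv mul0r.
Qed.

Lemma exists_generic (q : {poly kappa}) : q != 0 -> exists t, q.[t] != 0.
Proof. by move=> /closed_nonrootP [t]; exists t. Qed.

(** An equation [F] of a closed set containing [S] becomes a polynomial [G] in [t]. The product
    [q * G] vanishes at every [t], the bad values being roots of [q], so [G = 0] and in particular
    [F] holds at [t = 0]. *)
Lemma line_closure A B (U : subspaces W) (S : set (subspaces W)) :
  quiver_gr W x U -> (forall v, basis_of (U v) (mktuple (A v))) ->
  (forall t, t != 0 -> (forall v, free (mktuple (line_family A B t v))) ->
     exists2 N, S N & forall v, N v = <<mktuple (line_family A B t v)>>%VS) ->
  zariski_closure W x S U.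
Proof.
move=> grU basA curve Z [FF homF ->] SZ; split=> // F FF_F.
have [m hom] := homF F FF_F.
apply/(pl_vanishes_family hom grU.2 basA).
have [q q0 qfr] := generic_line B (fun v => basis_free (basA v)).
pose Mp (k : pl_index W x) :
  {poly kappa} := \det (\matrix_(a < x (tag k), b < x (tag k))
  ((coord (vbasis fullv) (tagged k b) (A (tag k) a))%:P +
   'X * (coord (vbasis fullv) (tagged k b) (B (tag k) a))%:P)).
have MpE (k : pl_index W x) t : (Mp k).[t] = family_minor (line_family A B t) k.
  rewrite /Mp /family_minor -horner_evalE -det_map_mx; congr (\det _).
  by apply/matrixP => a b;
    rewrite !mxE /= /horner_eval !hornerE /line_family linearD linearZ /=.
pose G : {poly kappa} := \sum_(mon <- msupp F)
  (F@_mon)%:P * \prod_i Mp (enum_val i) ^+ mon i.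
have GE t : G.[t] = F.@[fun i => family_minor (line_family A B t) (enum_val i)].
  rewrite mevalE /G horner_sum; apply: eq_bigr => mon _.
  rewrite hornerM hornerC horner_prod; congr (_ * _); apply: eq_bigr => i _.
  by rewrite horner_exp MpE.
have qG : q * G = 0.
  apply/eqP; apply/negPn/negP => /exists_generic [t];
    rewrite hornerM mulf_eq0 negb_or.
  case/andP => /qfr [t0 fr] /eqP; apply; rewrite GE.
  have [N SN NE] := curve t t0 fr.
  have [grN /(_ F FF_F) van] := SZ N SN.
  have basN v : basis_of (N v) (mktuple (line_family A B t v)).
    by rewrite /basis_of NE eqxx fr.
  exact: (pl_vanishes_family hom grN.2 basN).1 van.
have /eqP := qG; rewrite mulf_eq0 (negPf q0) /= => /eqP G0.
have := GE 0; rewrite G0 horner0 => ->.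
congr (_.@[_]); apply/funext => i; congr (\det _); apply/matrixP => a b.
by rewrite !mxE /line_family scale0r addr0.
Qed.

End Curves.

Arguments line_family {kappa I T W x} A B t v a.

(** * Closedness of rank conditions *)

Section RankCondition.
Variables (kappa : fieldType) (I : finType) (T : rel I) (W : qrep kappa T).
Variables (x : I -> nat) (e : oedge T).
Implicit Types U : subspaces W.

Local Notation v := (source e).
Local Notation bas := (vbasis (fullv : {vspace W v})).
Local Notation test_map := 'Hom(W v, 'rV[kappa]_(x v)).

Definition pl_at (J : {ffun 'I_(x v) -> 'I_(\dim {: W v})}) : pl_index W x :=
  existT (fun u => {ffun 'I_(x u) -> 'I_(\dim {: W u})}) v J.

(* The determinant of [g] restricted to [U v], expanded as a linear form in the
   Pluecker coordinates of [U v]. *)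
Definition det_equation (g : test_map) : {mpoly kappa[#|{: pl_index W x}|]} :=
  \sum_(J : {ffun 'I_(x v) -> 'I_(\dim {: W v})})
    (\prod_b g bas`_(J b) 0 b) *:
      'X_(enum_rank (pl_at J)).

Lemma det_equation_homogeneous g :
  multihomogeneous (fun u => (u == v) : nat) (det_equation g).
Proof.
move=> mon /msupp_sum_le /flatten_mapP [J _ /msuppZ_le].
rewrite msuppX inE => /eqP -> u.
rewrite big_mkcond (bigD1 (enum_rank (pl_at J))) //= enum_rankK /= mnm1E eqxx.
rewrite big1 ?addn0 => [|i ne]; first by rewrite eq_sym; case: eqP.
by rewrite mnm1E [_ == i]eq_sym (negPf ne) if_same.
Qed.

Lemma det_equation_vanishes g U :
  pl_vanishes (det_equation g) U <->
  \det (\matrix_(a < x v, b < x v) g (vbasis (U v))`_a 0 b) = 0.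
Proof.
rewrite /pl_vanishes /det_equation raddf_sum /=.
set lhs := \sum_(J : _) _.
suff -> : lhs = \det (\matrix_(a < x v, b < x v) g (vbasis (U v))`_a 0 b) by [].
pose A : 'M_(x v, \dim {: W v}) := \matrix_(a, i) coord bas i (vbasis (U v))`_a.
pose G : 'M_(\dim {: W v}, x v) := \matrix_(i, b) g bas`_i 0 b.
transitivity (\det (A *m G)).
  rewrite det_mul_expand; apply: eq_bigr => J _.
  rewrite mevalZ mevalXU enum_rankK /pluecker /=; congr (_ * _).
    by apply: eq_bigr => b _; rewrite mxE.
  by congr (\det _); apply/matrixP => a b; rewrite !mxE.
congr (\det _); apply/matrixP => a b; rewrite !mxE.
rewrite [in RHS](coord_vbasis (memvf (vbasis (U v))`_a)) linear_sum summxE.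
by apply: eq_bigr => i _; rewrite linearZ !mxE.
Qed.

(** The equations are determinants on [U v] of the maps [g] with [dim g(ker) + r < x v]. If the rank
    is at most [r], [U v] meets the kernel in dimension at least [x v - r], so no such [g] is
    injective on [U v]. *)
Lemma rank_closed (r : nat) : zariski_closed W x
  [set U | quiver_gr W x U /\ (rank_vector U e <= r)%N].
Proof.
exists [set p | exists g : test_map,
          (\dim (g @: lker (qmap W e)) + r < x v)%N /\ p = det_equation g].
  move=> _ [g [_ ->]]; exists (fun u => (u == v) : nat).
  exact: det_equation_homogeneous.
apply/seteqP; split=> U [grU hU]; have dimU : \dim (U v) = x v := grU.2 v;
    have dimK := limg_ker_dim (qmap W e) (U v); split=> //.
  move=> _ [g [gK ->]]; apply/det_equation_vanishes/eqP/negPn/negP => det0.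
  have inj y : y \in U v -> g y = 0 -> y = 0.
    move=> yU gy0;
      have sz : size (vbasis (U v)) == x v by rewrite size_tuple dimU.
    pose X := Tuple sz; have bX : basis_of (U v) X by apply: vbasisP.
    rewrite (coord_basis bX yU); pose c := \row_a coord X a y.
    have c0 : c = 0.
      have Munit :
        \matrix_(a < x v, b < x v) g (vbasis (U v))`_a 0 b \in unitmx.
        by rewrite unitmxE unitfE.
      rewrite -[LHS](mulmxK Munit) (_ : c *m _ = 0) ?mul0mx //.
      rewrite -[RHS]gy0 [in RHS](coord_basis bX yU) linear_sum.
      apply/rowP => b; rewrite mxE summxE; apply: eq_bigr => a _.
      by rewrite linearZ !mxE.
    by rewrite big1 // => a _; have /rowP /(_ a) := c0; rewrite !mxE => ->;
      rewrite scale0r.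
  pose K := (U v :&: lker (qmap W e))%VS.
  have dimgK : \dim (g @: K) = \dim K.
    apply: limg_dim_eq; apply/eqP; rewrite -subv0; apply/subvP => y.
    rewrite !memv_cap !memv_ker => /andP[/andP[yU _] /eqP gy]; rewrite memv0.
    by apply/eqP/inj.
  have := dimvS (limgS g (capvSr (U v) (lker (qmap W e)))); rewrite -/K dimgK.
  by move: hU dimK gK; rewrite /rank_vector -/K; lia.
rewrite leqNgt; apply/negP => ltr.
(* If the rank exceeds [r], the projection onto [U v] killing [K'] is a test map violating its
   equation: it sends the kernel into the image of [U v :&: lker], which is small enough, and has
   determinant 1 on [U v]. *)
pose K' := (lker (qmap W e) :\: U v)%VS.
have sz : size (vbasis (U v)) == x v by rewrite size_tuple dimU.
pose X := Tuple sz; have bX : basis_of (U v) X by apply: vbasisP.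
pose coords (y : W v) : 'rV[kappa]_(x v) := \row_b coord X b y.
have lin_coords : linear coords.
  by move=> k y z; apply/rowP => b; rewrite !mxE linearP.
pose g : test_map := (linfun coords \o daddv_pi (U v) K')%VF.
have K'U : (K' :&: U v = 0)%VS by apply: capv_diff.
have UK' : (U v :&: K' = 0)%VS by rewrite capvC.
have gK' y : y \in K' -> g y = 0.
  move=> yK'; rewrite comp_lfunE.
  have := daddv_pi_add UK' (subvP (addvSr (U v) K') y yK').
  rewrite (daddv_pi_id K'U yK') => /(canRL (addrK _)) ->.
  by rewrite subrr linear0.
have dimg : (\dim (g @: lker (qmap W e)) <= \dim (U v :&: lker (qmap W e)))%N.
  rewrite -{1}(addv_diff_cap (lker (qmap W e)) (U v)) limgD.
  have -> : (g @: K' = 0)%VS.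
    apply/eqP; rewrite -subv0; apply/subvP => _ /memv_imgP [y yK' ->].
    by rewrite gK' ?mem0v.
  by rewrite add0v capvC -(limg_ker_dim g (U v :&: _)) leq_addl.
have /hU /det_equation_vanishes : exists g0 : test_map,
    (\dim (g0 @:
      lker (qmap W e)) + r < x v)%N /\ det_equation g = det_equation g0.
  exists g; split=> //; move: ltr dimK dimg; rewrite /rank_vector; lia.
rewrite (_ : \matrix_(_, _) _ = 1%:M) ?det1 => [/eqP|];
  first by rewrite oner_eq0.
apply/matrixP => a b'; rewrite !mxE comp_lfunE daddv_pi_id //; last first.
  by apply/vbasis_mem/mem_nth; rewrite size_tuple dimU.
rewrite linfunE // mxE.
exact: (coord_free a b' (basis_free bX)).
Qed.

End RankCondition.

(** * Multiplicities from dimensions and ranks *)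

Section MultiplicitiesOfSubrepresentations.
Variables (kappa : fieldType) (I : finType) (T : rel I).
Variables (W : I -> vectType kappa) (f : forall i j, 'Hom(W i, W j)).
Hypothesis H : transition_system T f.
Implicit Types (u v w : I) (c : summand T) (Q : qrep kappa T).

Let symT := ts_sym H.

Lemma dim_multiplicities Q m v : has_multiplicities Q m ->
  \dim (fullv : {vspace Q v}) = (\sum_c m c * support c v)%N.
Proof.
move=> [J [t [b [[gen fr b0 tr] cnt]]]].
by rewrite -(sum_fibers (fun c => support c v : nat) cnt) (dim_family (b0 v)).
Qed.

Lemma edge_multiplicity Q m (e : oedge T) : has_multiplicities Q m ->
  \dim (fullv : {vspace Q (source e)}) =
  (m (inr e) + \dim (limg (qmap Q (reverse symT e))) + \dim (limg (qmap Q
    e)))%N.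
Proof.
move=> Qm; rewrite (dim_multiplicities _ Qm) !(rank_multiplicities _ Qm).
under eq_bigr do rewrite (support_edge H _ (oedgeP e)) !mulnDr.
rewrite !big_split /=; congr (_ + _ + _)%N.
rewrite (bigD1 (inr e)) //= -surjective_pairing eqxx muln1 big1 ?addn0 // =>
  -[u|e'] /= ne.
  by rewrite muln0.
case: eqP => [E|]; last by rewrite muln0.
by case/eqP: ne; congr inr; apply: val_inj; rewrite /= E -surjective_pairing.
Qed.

(** The edge formula gives the multiplicity of each [R_e]. In [support_vertex] summed over the
    summands, the transmitted terms are ranks, so only [m (inl v)] is left. *)
Lemma multiplicities_unique Q m m' Q' :
  has_multiplicities Q m -> has_multiplicities Q' m' ->
  (forall v, \dim (fullv : {vspace Q v}) = \dim (fullv : {vspace Q' v})) ->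
  (forall e, \dim (limg (qmap Q e)) = \dim (limg (qmap Q' e))) ->
  m =1 m'.
Proof.
move=> Qm Qm' dimE rkE.
have mE e : m (inr e) = m' (inr e).
  have := edge_multiplicity e Qm;
    rewrite dimE !rkE (edge_multiplicity e Qm'); lia.
case=> [v|//].
have := dimE v; rewrite (dim_multiplicities _ Qm) (dim_multiplicities _ Qm').
have split (k : summand T -> nat) : (\sum_c k c * support c v =
    k (inl v) + \sum_(w | T v w) (\sum_c k c * kernel_at c v w +
                                  \sum_c k c * transmits c w v))%N.
  under eq_bigr do rewrite (support_vertex H) mulnDr big_distrr /=.
  rewrite big_split /= exchange_big /=; congr addn.
    rewrite (bigD1 (inl v)) //= eqxx muln1 big1 ?addn0 // => c.
    by move=> /negPf ->; rewrite muln0.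
  apply: eq_bigr => w vw; rewrite -big_split /=.
  by apply: eq_bigr => c _; rewrite mulnDr.
rewrite !split => /eqP; rewrite (eq_bigr (fun w =>
    \sum_c m' c * kernel_at c v w + \sum_c m' c * transmits c w v)%N).
  by rewrite eqn_add2r => /eqP.
move=> w vw; congr addn.
  by apply: eq_bigr => -[u|e] _ /=; rewrite ?muln0 ?mE.
have wv : T w v by rewrite symT.
pose e : oedge T := exist (fun e : I * I => T e.1 e.2) (w, v) wv.
by have := rkE e;
  rewrite (rank_multiplicities _ Qm) (rank_multiplicities _ Qm').
Qed.

Lemma subrep_dim (Q : qrep kappa T) (U : subspaces Q) v :
  \dim (fullv : {vspace subrep U v}) = \dim (U v).
Proof. by rewrite dimvf. Qed.

Lemma subrep_rank Q (U : subspaces Q) (e : oedge T) : is_subrep U ->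
  \dim (limg (qmap (subrep U) e)) = rank_vector U e.
Proof.
move=> subU; pose i v : 'Hom(subvs_of (U v), Q v) := linfun vsval.
have iE v y : i v y = vsval y by rewrite lfunE.
have ker0 v X : (X :&: lker (i v) = 0)%VS.
  apply/eqP; rewrite -subv0; apply/subvP => y.
  rewrite memv_cap memv_ker memv0 iE => /andP[_ /eqP y0].
  by apply/eqP/subvs_inj; rewrite y0.
have imi v : limg (i v) = U v.
  apply/vspaceP => y; apply/memv_imgP/idP => [[z _ ->]|yU].
    by rewrite iE subvsP.
  by exists (vsproj (U v) y); rewrite ?memvf // iE vsprojK.
rewrite -(limg_dim_eq (ker0 (target e) _)) -limg_comp /rank_vector -[in RHS]imi.
rewrite -limg_comp; congr (\dim (_ @: _)%VS); apply/lfunP => y.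
rewrite !comp_lfunE !iE /= linfunE => [|k a b]; last by rewrite !linearP.
by rewrite vsprojK //; apply/(subvP (subU e))/memv_img/subvsP.
Qed.

Lemma qiso_rank Q Q' (e : oedge T) : qiso Q Q' ->
  \dim (limg (qmap Q e)) = \dim (limg (qmap Q' e)).
Proof.
move=> [phi [bij com]].
have ker0 v X : (X :&: lker (phi v) = 0)%VS.
  apply/eqP; rewrite -subv0; apply/subvP => y.
  rewrite memv_cap memv_ker memv0 => /andP[_ /eqP y0].
  by apply/eqP/(bij_inj (bij v)); rewrite y0 linear0.
have imp v : limg (phi v) = fullv.
  apply/vspaceP => y; rewrite memvf; apply/memv_imgP.
  by have [psi _ K] := bij v; exists (psi y); rewrite ?memvf ?K.
rewrite -(limg_dim_eq (ker0 _ _)) -limg_comp -(imp (source e)) -limg_comp.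
by congr (\dim (_ @: _)%VS); apply/lfunP => y; rewrite !comp_lfunE com.
Qed.

End MultiplicitiesOfSubrepresentations.

(** * Perturbing [R_e (+) R_{rev e}] into [P_{s(e)}] *)

Lemma sum_sig (K : finType) (P : pred K) (F : K -> nat) :
  (\sum_(k : {k | P k}) F (val k) = \sum_(k | P k) F k)%N.
Proof.
rewrite [RHS](reindex_omap (val : {k | P k} -> K) insub) => [|k Pk];
  last by rewrite insubT.
by apply: eq_bigl => -[k Pk]; rewrite Pk valK eqxx.
Qed.

Lemma mktuple_nth (A B : Type) (a0 : A) (s : seq A) (n : nat) (F : A -> B) :
  size s = n -> mktuple (fun i : 'I_n => F (nth a0 s i)) = map F s :> seq B.
Proof.
move=> <-; case: s => [|a s']; first by apply: size0nil; rewrite size_tuple.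
apply: (@eq_from_nth _ (F a0)); first by rewrite size_tuple size_map.
move=> i; rewrite size_tuple => lt.
by rewrite (nth_map a0) // -[i]/(val (Ordinal lt)) nth_mktuple.
Qed.

Section Perturbation.
Variables (kappa : closedFieldType) (I : finType) (T : rel I).
Variables (W : I -> vectType kappa) (f : forall i j, 'Hom(W i, W j)).
Hypothesis H : transition_system T f.
Variable x : I -> nat.
Implicit Types (u v w : I) (c : summand T) (U N : subspaces (config_rep T f)).
Local Notation away := (away T).

Let symT := ts_sym H.
Let irrT := ts_irr H.
Let conn := ts_conn H.

(** [adapted] speaks of arrows only; composing along a geodesic extends it to [f] between any two
    vertices. *)
Lemma adapted_transition U (J : finType) (t : J -> summand T)
    (b : forall v, J -> subrep U v) (subU : is_subrep U) j v : adapted t b ->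
  f (origin (t j)) v (vsval (b (origin (t j)) j)) = vsval (b v j).
Proof.
move=> [gen fr b0 tr]; set u := origin (t j).
move: {2}(dist T u v) (erefl (dist T u v)) => k; elim: k v => [|k IH] v duv.
  by rewrite -(dist_eq0 conn duv) (ts_refl H) id_lfunE.
have [w wv dw] : exists2 w, T w v & dist T u v = (dist T u w).+1.
  by apply: (dist_pred conn); apply/eqP => uv; rewrite uv dist_refl in duv.
rewrite -(transition_geodesic H wv dw) comp_lfunE IH; last by lia.
pose e : oedge T := exist (fun e : I * I => T e.1 e.2) (w, v) wv.
have := tr e j; rewrite /away dw eqxx => <-.
rewrite /= linfunE => [|k' y z]; last by rewrite !linearP.
by rewrite vsprojK //; apply/(subvP (subU e))/memv_img/subvsP.
Qed.

(** By [qiso_multiplicities], [S] is a single isomorphism class, and it collects all the [N_t]. The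
    relation between [m] and [m'] is additive to avoid truncated subtraction. *)
Lemma perturbation U m m' (e : oedge T) :
  quiver_gr (config_rep T f) x U -> has_multiplicities (subrep U) m ->
  (0 < m (inr e))%N -> (0 < m (inr (reverse symT e)))%N ->
  (forall c, m' c + (c == inr e) + (c == inr (reverse symT e)) =
             m c + (c == inl (source e)))%N ->
  let S := [set N | quiver_gr (config_rep T f) x N /\
                    has_multiplicities (subrep N) m'] in
  zariski_closure (config_rep T f) x S U /\ exists N, S N.
Proof.
move=> grU Um; have := Um; move=> [J [t [b' [ad cnt]]]] me mre m'E S.
have [subU dimU] := grU; have [gen' fr' b0' tr'] := ad.
set a := source e; set z := target e; set re := reverse symT e.
have az : T a z := oedgeP e; have za : T z a by rewrite symT.
pose b v j : W v := vsval (b' v j).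
have bsum v (d : J -> kappa) : \sum_j d j *: b v j = vsval (\sum_j d j *:
  b' v j).
  by rewrite linear_sum; apply: eq_bigr => j _; rewrite linearZ.
have gen v : generates (U v) (b v).
  split=> [j | y yU]; first exact: subvsP.
  have [d Ed] := (gen' v).2 (vsproj (U v) y) (memvf _); exists d.
  by rewrite bsum -Ed vsprojK.
have fr v : free_on (fun j => support (t j) v) (b v).
  by move=> d; rewrite bsum => d0; apply: fr'; apply: subvs_inj.
have b0 v j : ~~ support (t j) v -> b v j = 0 by move=> s0; rewrite /b b0'.
have bE j v : f (origin (t j)) v (b (origin (t j)) j) = b v j.
  exact: adapted_transition ad.
have exj c : (0 < m c)%N -> exists j, t j == c.
  move=> mc; case: (pickP (fun j => t j == c)) => [j tj | t0];
    first by exists j.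
  by move: mc; rewrite -cnt big1 // => j _; rewrite t0.
have [j1 /eqP tj1] := exj _ me; have [j2 /eqP tj2] := exj _ mre.
have j12 : j1 != j2.
  apply/eqP => E; move: tj2; rewrite -E tj1 => -[] /(congr1 (@source I T)) Ea.
  by move: az; rewrite /a Ea irrT.
have [w Ew] : exists w : W a, f a z w = b z j2.
  have : b z j2 \in lker (f z a).
    rewrite memv_ker; have := bE j2 a; rewrite tj2 => /= ->.
    by rewrite b0 // tj2 /= /away dist_refl.
  by rewrite (ts_ker H za) => /memv_imgP [w _ ->]; exists w.
(* [w] need not lie in [U a]. Its transports give the direction in which the vectors of [j1] move
   towards a copy of [P_a]. *)
pose B v j : W v := if j == j1 then f a v w else 0.
pose c tt v j := b v j + tt *: B v j.
pose Sv v := [pred j | support (t j) v].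
have sizeS v : size (enum (Sv v)) = x v.
  rewrite -cardE -dimU (dim_family (P := Sv v) (b0 v) (gen v) (fr v)).
  by rewrite -sum1_card big_mkcond.
(* Among the summands supported at [v], [j1] occurs exactly on [A_e] and [j2] exactly off it; hence
   the line moves [U v] only for [v] in [A_e]. The default of [nth] is never reached. *)
pose A v (i : 'I_(x v)) := b v (nth j1 (enum (Sv v)) i).
pose B' v (i : 'I_(x v)) := B v (nth j1 (enum (Sv v)) i).
have AE v : mktuple (A v) = [seq b v j | j in Sv v] :> seq _.
  exact: mktuple_nth.
have cE tt v : mktuple (line_family (A :
  vector_family (config_rep T f) x) B' tt v) =
    [seq c tt v j | j in Sv v] :> seq _.
  exact: (mktuple_nth j1 (c tt v) (sizeS v)).
have basA v : basis_of (U v) (mktuple (A v)).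
  rewrite /basis_of AE (span_image (b0 v) (gen v)) eqxx /=.
  exact/(free_image (b0 v)).
have s1 v : support (t j1) v = away v a z by rewrite tj1.
have s2 v :
  support (t j2) v = ~~ away v a z by rewrite tj2 /= -(away_sym H v az).
have c_j tt v j : j != j1 -> c tt v j = b v j.
  by move=> jj1; rewrite /c /B (negPf jj1) scaler0 addr0.
have c_j1 tt v : ~~ away v a z -> c tt v j1 = tt *: b v j2.
  move=> nv; rewrite /c /B eqxx b0 ?s1 // add0r; congr (_ *: _).
  have bz : f z v (b z j2) = b v j2 by have := bE j2 v; rewrite tj2.
  rewrite -bz -Ew.
  move: nv; rewrite -(away_sym H v az) => /eqP.
  rewrite !(dist_sym conn symT v) => dv.
  by rewrite -(transition_geodesic_l H az dv) comp_lfunE.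
(* [j2] is dropped and [j1] relabelled as [P_a]: off [A_e] the vector [c tt v j1] equals
   [tt *: b v j2] and takes over its place, provided [tt != 0]. *)
pose K := {j | j != j2}.
pose tK (k : K) := if val k == j1 then inl a else t (val k).
have tKE (F : summand T -> nat) :
    (\sum_k F (tK k) + F (inr e) + F (inr re) = \sum_j F (t j) + F (inl a))%N.
  rewrite (sum_sig (fun j => j != j2) (fun j =>
    F (if j == j1 then inl a else t j))).
  rewrite [X in _ = (X + _)%N](bigD1 j2) //= tj2 -/re.
  rewrite (bigD1 j1) //= [X in _ = (_ + X + _)%N](bigD1 j1) //= eqxx tj1.
  rewrite (eq_bigr (fun j => F (t j))); first by lia.
  by move=> j /andP[_ /negPf ->].
have member tt : tt != 0 ->
    (forall v, free (mktuple (line_family (A :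
      vector_family (config_rep T f) x) B' tt v))) ->
    exists2 N, S N & forall v,
      N v = <<mktuple (line_family (A :
        vector_family (config_rep T f) x) B' tt v)>>%VS.
  move=> tt0 frt; pose bK v (k : K) := c tt v (val k).
  pose N : subspaces (config_rep T f) := fun v => <<[seq bK v k | k : K]>>%VS.
  have genN v : generates (N v) (bK v) by apply: generates_span.
  have inN v j : j != j2 -> c tt v j \in N v.
    by move=> jj2; apply: ((genN v).1 (Sub j jj2)).
  have NE v : N v = <<mktuple (line_family (A :
    vector_family (config_rep T f) x) B' tt v)>>%VS.
    rewrite cE; apply/eqP; rewrite eqEsubv; apply/andP; split;
      apply/span_subvP => y.
      case/fintype.imageP => k _ ->; rewrite /bK.
      have [sk | nsk] := boolP (support (t (val k)) v).
        exact/memv_span/fintype.image_f.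
      have [k1 | nk1] := eqVneq (val k) j1; last by rewrite c_j // b0 ?mem0v.
      have nv : ~~ away v a z by rewrite -s1 -k1.
      rewrite k1 c_j1 // -(c_j tt); last by rewrite eq_sym.
      by apply/memvZ/memv_span/fintype.image_f; rewrite inE s2.
    case/fintype.imageP => j; rewrite inE => sj ->.
    have [E | jj2] := eqVneq j j2; last exact: inN.
    have nv : ~~ away v a z by rewrite -s2 -E.
    rewrite E c_j 1?eq_sym // -[b v j2](scalerK tt0) -c_j1 //.
    exact/memvZ/inN.
  have dimN v : \dim (N v) = x v.
    by rewrite NE (eqP (frt v)) size_tuple.
  (* For [j1], both [b v j1] and the added [f a v w] follow the arrow rule of origin [a], which
     [R_e] and [P_a] share. *)
  have trN (e' : oedge T) j : f (source e') (target e') (c tt (source e') j) =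
      if away (origin (t j)) (source e') (target e') then c tt (target e') j
        else 0.
    have tb := congr1 vsval (tr' e' j); move: tb.
    rewrite /= linfunE => [|k' y y']; last by rewrite !linearP.
    rewrite vsprojK => [tb|]; last by apply/(subvP (subU e'))/memv_img/subvsP.
    rewrite /c linearD linearZ /= [f _ _ (b _ j)]tb /B.
    case: eqP => [->|_]; last by rewrite linear0 scaler0 !addr0; case: ifP.
    rewrite -comp_lfunE (transition_edge H _ (oedgeP e')) tj1 /= -/(away _ _
      _) -/a.
    by case: ifP => _ //; rewrite zero_lfunE scaler0 addr0.
  have subN : is_subrep N.
    move=> e'; rewrite limg_span;
      apply/span_subvP => y /mapP [_ /fintype.imageP [k _ ->] ->].
    rewrite trN; case: ifP => _; last exact: mem0v.
    exact/inN/(valP k).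
  have bK0 v k : ~~ support (tK k) v -> bK v k = 0.
    rewrite /tK /bK; case: eqP => // /eqP nk sk.
    by rewrite c_j // b0.
  exists N => //; split=> //.
  exists K, tK, (fun v k => vsproj (N v) (bK v k)); split; last first.
    move=> cc; have := tKE (fun c' => (c' == cc) : nat); rewrite cnt.
    rewrite ![_ == cc]eq_sym => E; have := m'E cc; rewrite -/a -/re -E.
    by move=> /eqP; rewrite !eqn_add2r => /eqP ->.
  have sumE v (d : K -> kappa) :
      vsval (\sum_k d k *: vsproj (N v) (bK v k)) = \sum_k d k *: bK v k.
    rewrite linear_sum; apply: eq_bigr => k _.
    by rewrite linearZ /= vsprojK ?(genN v).1.
  split.
  - move=> v; split=> [k | y _]; first exact: memvf.
    have [d Ed] := (genN v).2 (vsval y) (subvsP y).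
    by exists d; apply: subvs_inj; rewrite sumE.
  - move=> v d d0; apply: (free_family (b := bK v) (bK0 v) (genN v)).
      rewrite dimN -dimU (dim_family (b0 v) (gen v) (fr v)).
      have := tKE (fun c' => support c' v : nat).
      rewrite -addnA (support_reverse H e v) => /eqP.
      by rewrite eqn_add2r => /eqP ->.
    by rewrite -sumE d0 linear0.
  - by move=> v k /bK0 ->; rewrite linear0.
  move=> e' k; rewrite /= linfunE => [|k' y y']; last by rewrite !linearP.
  rewrite vsprojK ?(genN _).1 // /bK trN.
  have -> : origin (tK k) = origin (t (val k)).
    by rewrite /tK; case: eqP => [->|//]; rewrite tj1.
  by case: ifP => //; rewrite linear0.
split.
  apply: (line_closure (A := A :
    vector_family (config_rep T f) x) (B := B')) => //.
have [q q0 qfr] := generic_line (B' : vector_family (config_rep T f) x)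
                     (fun v => basis_free (basA v)).
have [tt qt] := exists_generic q0; have [tt0 frt] := qfr tt qt.
by have [N SN _] := member tt tt0 frt; exists N.
Qed.

End Perturbation.

(** * Degenerations *)

Lemma sum_delta (C : finType) (k : C) (F : C -> nat) :
  (\sum_c (c == k) * F c = F k)%N.
Proof.
rewrite (bigD1 k) //= eqxx mul1n big1 ?addn0 // => c.
by move=> /negPf ->; rewrite mul0n.
Qed.

Section Degenerations.
Variables (kappa : closedFieldType) (I : finType) (T : rel I).
Variables (W : I -> vectType kappa) (f : forall i j, 'Hom(W i, W j)).
Hypothesis H : transition_system T f.
Variable x : I -> nat.
Local Notation MGamma := (config_rep T f).
Implicit Types (U N : subspaces MGamma) (e : oedge T) (m : summand T -> nat).

Let symT := ts_sym H.
Local Notation rev := (reverse symT).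

Lemma reverse_neq e : rev e != e.
Proof.
apply/eqP => /(congr1 (@source I T)) E; have := oedgeP e.
by rewrite -[X in T X _]E (ts_irr H).
Qed.

Lemma subrep_multiplicities_unique U U' m m' :
  quiver_gr MGamma x U -> quiver_gr MGamma x U' ->
  has_multiplicities (subrep U) m -> has_multiplicities (subrep U') m' ->
  rank_vector U =1 rank_vector U' -> m =1 m'.
Proof.
move=> [subU dimU] [subU' dimU'] Um Um' rkE.
apply: (multiplicities_unique H Um Um') => [v|e].
  by rewrite !subrep_dim dimU dimU'.
by rewrite !subrep_rank.
Qed.

Lemma stratum_rank U U' e : is_subrep U' ->
  stratum MGamma x (subrep U') U -> rank_vector U e = rank_vector U' e.
Proof. by move=> subU' [[subU _] iso];
  rewrite -!subrep_rank // (qiso_rank e iso). Qed.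

Lemma degenerates_rank U U' e : quiver_gr MGamma x U' ->
  degenerates x U U' -> (rank_vector U e <= rank_vector U' e)%N.
Proof.
move=> [subU' _] deg.
have [|_ //] := deg _ (rank_closed MGamma x e (rank_vector U' e)).
by move=> N SN; split; [case: SN | rewrite (stratum_rank e subU' SN)].
Qed.

Lemma rank_perturbation U N m m' e e' :
  is_subrep U -> is_subrep N ->
  has_multiplicities (subrep U) m -> has_multiplicities (subrep N) m' ->
  (forall c, m' c + (c == inr e) + (c == inr (rev e)) =
             m c + (c == inl (source e)))%N ->
  rank_vector N e' = (rank_vector U e' + (e' == e))%N.
Proof.
move=> subU subN Um Nm' m'E.
rewrite -!subrep_rank // (rank_multiplicities _ Um) (rank_multiplicities _ Nm').
pose tr (c : summand T) : nat := transmits c (source e') (target e').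
have : (\sum_c m' c * tr c + tr (inr e) + tr (inr (rev e)) =
        \sum_c m c * tr c + tr (inl (source e)))%N.
  rewrite -(sum_delta (inr e) tr) -(sum_delta (inr (rev e)) tr).
  rewrite -(sum_delta (inl (source e)) tr) -!big_split /=.
  by apply: eq_bigr => c _; rewrite -!mulnDl m'E.
have -> : tr (inl (source e)) = (tr (inr e) + tr (inr (rev e)) + (e' == e))%N.
  rewrite /tr (transmits_reverse H _ (oedgeP e')) -surjective_pairing.
  by rewrite (eq_sym e').
by rewrite /tr; lia.
Qed.

Lemma rank_degenerates U U' :
  quiver_gr MGamma x U -> quiver_gr MGamma x U' ->
  (forall e, rank_vector U e <= rank_vector U' e)%N -> degenerates x U U'.
Proof.
move=> grU grU'.
pose defect U := (\sum_e (rank_vector U' e - rank_vector U e))%N.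
move: {2}(defect U).+1 (ltnSn (defect U)) => k.
elim: k U grU => // k IH U grU ltk le_rk.
have [subU dimU] := grU; have [subU' dimU'] := grU'.
have [m Um] := subrep_has_multiplicities H subU.
have [m' Um'] := subrep_has_multiplicities H subU'.
have [[e lt_e] | all_eq] := pselect (exists e, rank_vector U e < rank_vector
  U' e)%N;
    last first.
  have E : m =1 m'.
    apply: (subrep_multiplicities_unique grU grU' Um Um') => e.
    apply/eqP; rewrite eqn_leq le_rk leqNgt; apply/negP => lt_e.
    by apply: all_eq; exists e.
  move=> Z _; apply; split=> //.
  exact: qiso_multiplicities (has_multiplicities_ext E Um) Um'.
(* Dimensions agree, so the gain in the two ranks at an edge equals the loss of multiplicity, for
   either orientation; a strict gain makes both multiplicities in [U] positive. *)
have edgeE e' : (m (inr e') + rank_vector U (rev e') + rank_vector U e' =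
    m' (inr e') + rank_vector U' (rev e') + rank_vector U' e')%N.
  have := edge_multiplicity H e' Um; have := edge_multiplicity H e' Um'.
  by rewrite !subrep_dim !subrep_rank // dimU dimU' => <- <-.
have revK : rev (rev e) = e by apply: val_inj; rewrite /= -surjective_pairing.
have me : (0 < m (inr e))%N.
  by have := edgeE e; have := le_rk (rev e); lia.
have mre : (0 < m (inr (rev e)))%N.
  by have := edgeE (rev e); have := le_rk (rev e); rewrite revK; lia.
(* The truncated subtraction is exact: both multiplicities are positive and [rev e != e]. *)
pose mN c := (m c + (c == inl (source e)) - (c == inr e) - (c == inr (rev
  e)))%N.
have mNE c : (mN c + (c == inr e) + (c == inr (rev e)) =
              m c + (c == inl (source e)))%N.
  rewrite /mN; case: (eqVneq c (inr e)) => [-> | _].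
    rewrite [inr e == inr _]eq_sym.
    have -> : (inr (rev e) == inr e :> summand T) = false.
      by apply/negbTE; apply: contra_neq (reverse_neq e) => -[].
    by lia.
  by case: (eqVneq c (inr (rev e))) => [-> | _]; lia.
have [cl _] := perturbation grU Um me mre mNE.
(* Transitivity: a closed set containing the stratum of [U'] contains by induction every
   perturbation [N], hence also [U]. *)
move=> Z clZ subZ; apply: (cl Z clZ) => N [grN Nm].
have rkN e' := rank_perturbation e' subU grN.1 Um Nm mNE.
apply: (IH N grN) => // [|e']; last first.
  by rewrite rkN; case: eqP => [->|_]; rewrite ?addn1 ?addn0.
rewrite ltnS in ltk; apply: leq_trans ltk;
  rewrite /defect (bigD1 e) //= [X in (_ < X)%N](bigD1 e) //=.
rewrite rkN eqxx -addSn leq_add //; first by lia.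
by apply: leq_sum => e' _; rewrite rkN; lia.
Qed.

(** One [N] serves the whole stratum: every [U1] in it has the multiplicities of [U], so its
    perturbations have those of [N] and are isomorphic to [N]. *)
Lemma stratum_closure U m m' e :
  quiver_gr MGamma x U -> has_multiplicities (subrep U) m ->
  (0 < m (inr e))%N -> (0 < m (inr (rev e)))%N ->
  (forall c, m' c + (c == inr e) + (c == inr (rev e)) =
             m c + (c == inl (source e)))%N ->
  exists N, [/\ quiver_gr MGamma x N, has_multiplicities (subrep N) m' &
    stratum MGamma x (subrep U) `<=`
      zariski_closure MGamma x (stratum MGamma x (subrep N))].
Proof.
move=> grU Um me mre m'E.
have [_ [N [grN Nm']]] := perturbation grU Um me mre m'E.
exists N; split=> // U1 [grU1 iso1].
have U1m : has_multiplicities (subrep U1) m.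
  by apply: has_multiplicities_iso Um; apply: qiso_sym.
have [cl _] := perturbation grU1 U1m me mre m'E.
move=> Z clZ subZ; apply: (cl Z clZ) => N1 [grN1 N1m']; apply: subZ.
by split=> //; apply: qiso_multiplicities N1m' Nm'.
Qed.

End Degenerations.

Theorem proposition3p7
  (R : idomainType) (p : R) (hR : is_dvr p)
  (kappa : closedFieldType) (res : {rmorphism R -> kappa})
  (hres : is_residue_map p res)
  (V : vectType {fraction R})
  (I : finType) (L : I -> set V)
  (hL : is_configuration L) (hconv : is_convex L)
  (n : I -> I -> int)
  (hn : forall i j, is_min_exponent p (L i) (L j) (n i j))
  (Lbar : I -> vectType kappa) (red : forall i, V -> Lbar i)
  (hred : forall i, is_reduction p res (L i) (red i))
  (f : forall i j, 'Hom(Lbar i, Lbar j))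
  (hf : forall i j (y : V), L i y ->
     f i j (red i y) = red j (tofrac p ^ n i j *: y))
  (hind : locally_linearly_independent p L f)
  (x : I -> nat) :
  let T := class_graph p L in
  let rev := reverse (class_graph_sym p L) in
  let MGamma := config_rep T f in
  forall M M' : subspaces MGamma,
  quiver_gr MGamma x M -> quiver_gr MGamma x M' ->
  (forall (r : I -> nat) (rE : oedge T -> nat),
     qiso (subrep M)
       (qsum (qbigsum xpredT (fun v : I => qpow (P_rep kappa T v) (r v)))
             (qbigsum xpredT (fun e : oedge T => qpow (R_rep kappa e) (rE e)))) ->
     forall iota : oedge T, (0 < rE iota)%N -> (0 < rE (rev iota))%N ->
     exists N : subspaces MGamma,
       [/\ quiver_gr MGamma x N,
           stratum MGamma x (subrep M) `<=`
             zariski_closure MGamma x (stratum MGamma x (subrep N))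
         & qiso (subrep N)
             (qsum (qbigsum xpredT (fun v : I => qpow (P_rep kappa T v) (r v)))
             (qsum (qbigsum (fun e : oedge T => (e != iota) && (e != rev iota))
                            (fun e : oedge T => qpow (R_rep kappa e) (rE e)))
             (qsum (qpow (R_rep kappa iota) (rE iota).-1)
             (qsum (qpow (R_rep kappa (rev iota)) (rE (rev iota)).-1)
                   (P_rep kappa T (source iota))))))])
  /\
  (degenerates x M M' <->
     (forall e : oedge T, rank_vector M e <= rank_vector M' e)%N).
Proof.
move=> T rev MGamma M M' grM grM'.
have [symT irrT] : symmetric T /\ irreflexive T.
  by split; [apply: class_graph_sym | move=> i; rewrite /T /class_graph eqxx].
have H : transition_system T f.
  split=> //.
  - exact: (class_graph_connected hR hL hconv hn).
  - exact: (transition_refl hR hL hn hred hf).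
  - exact: (transition_neq0 hR hL hn hred hf).
  - exact: (transition_comp hR hL hn hred hf).
  - exact: (transition_ker hR hL hn hred hf).
(* The two reversals differ only in the proof that [T] is symmetric. *)
have revE e : rev e = reverse (ts_sym H) e by apply: val_inj.
split; last first.
  split=> [deg e | le]; first exact: degenerates_rank grM' deg.
  exact: (rank_degenerates H) le.
move=> r rE isoM iota rE1 rE2.
have pows (J : finType) (P : pred J) (k : J -> nat) (Q : J -> qrep kappa T)
    (c0 : J -> summand T) :
    (forall j, has_multiplicities (Q j) (fun c => (c == c0 j) : nat)) ->
    has_multiplicities (qbigsum P (fun j => qpow (Q j) (k j)))
      (fun c => \sum_(j | P j) k j * (c == c0 j))%N.
  by move=> Qm; apply: has_multiplicities_bigsum => j;
    apply: has_multiplicities_pow.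
have Psum := pows _ xpredT r _ _ (has_multiplicities_P H).
have Rsum := pows _ _ rE _ _ (has_multiplicities_R H).
have Rpow e k := has_multiplicities_pow k (has_multiplicities_R H e).
pose mP (c : summand T) := (\sum_v r v * (c == inl v))%N.
pose mR (c : summand T) := (\sum_e rE e * (c == inr e))%N.
have Mm : has_multiplicities (subrep M) (fun c => mP c + mR c)%N.
  apply: has_multiplicities_iso (qiso_sym isoM) _.
  exact: has_multiplicities_sum Psum (Rsum xpredT).
have mR_inr e : mR (inr e) = rE e.
  rewrite /mR (bigD1 e) //= eqxx muln1 big1 ?addn0 // => e' ne.
  by rewrite eq_sym (_ : _ == _ = (e' == e)) // (negPf ne) muln0.
have rev_neq : rev iota != iota by rewrite revE; apply: reverse_neq.
pose mR' (c : summand T) :=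
  (\sum_(e | (e != iota) && (e != rev iota)) rE e * (c == inr e))%N.
pose m' (c : summand T) := (mP c + (mR' c +
  ((rE iota).-1 * (c == inr iota) + ((rE (rev iota)).-1 * (c == inr (rev
    iota)) +
  (c == inl (source iota))))))%N.
have Nm := has_multiplicities_sum Psum
  (has_multiplicities_sum (Rsum (fun e => (e != iota) && (e != rev iota)))
  (has_multiplicities_sum (Rpow iota (rE iota).-1)
  (has_multiplicities_sum (Rpow (rev iota) (rE (rev iota)).-1)
     (has_multiplicities_P H (source iota))))).
have me : (0 < mP (inr iota) + mR (inr iota))%N by rewrite mR_inr ltn_addl.
have mre : (0 < mP (inr (rev iota)) + mR (inr (rev iota)))%N.
  by rewrite mR_inr ltn_addl.
have m'E c : (m' c + (c == inr iota) + (c == inr (rev iota)) =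
              mP c + mR c + (c == inl (source iota)))%N.
  rewrite /mR (bigD1 iota) //= (bigD1 (rev iota)) //= -/(mR' c) /m'.
  by case: (c == inr iota); case: (c == inr (rev iota)); lia.
rewrite revE in mre m'E.
have [N [grN Nm' cl]] := stratum_closure grM Mm me mre m'E.
exists N; split=> //.
exact: qiso_multiplicities Nm' Nm.
Qed.
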